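(* Let $\Lambda=\mathcal{E}^n$ and $L=\Lambda\oplus II_{1,1}^{\mathcal{E}}$. (i) If $n=1$ then $\mathrm{Reflec}_0\,L$ acts with exactly $2$ orbits on primitive null vectors of $L$, represented by $\pm\rho$. If $n=2$ or $3$ then $\mathrm{Reflec}_0\,L$ acts transitively on the primitive null vectors of $L$. (ii) If $n=1$, $2$ or $3$ then $\mathrm{Aut}\,L=\mathrm{Reflec}\,L=\mathrm{Reflec}_0\,L\times\{\pm I\}$.
   Context: $\mathcal{E}=\mathbb{Z}[\omega]$, $\omega=(-1+\sqrt{-3})/2$. An $\mathcal{E}$-lattice is a free $\mathcal{E}$-module of finite rank with an $\mathcal{E}$-valued Hermitian form $\langle\cdot|\cdot\rangle$, conjugate-linear in the first variable and linear in the second. $\mathcal{E}^n$ carries the form $\sum\bar x_iy_i$; $II_{1,1}^{\mathcal{E}}$ is $\mathcal{E}^2$ with inner product matrix $\begin{pmatrix}0&1\\1&0\end{pmatrix}$. Elements of $L=\Lambda\oplus II_{1,1}^{\mathcal{E}}$ are written $(\lambda;\mu,\nu)$ with $\lambda\in\Lambda$, $\mu,\nu\in\mathcal{E}$, and $\rho=(0;0,1)$. The norm of $v$ is $v^2=\langle v|v\rangle$; $v$ is null if $v^2=0$. A nonzero $v\in L$ is primitive if $v=w\alpha$ with $w\in L$, $\alpha\in\mathcal{E}$ implies $\alpha$ is a unit. For $r\in L\otimes\mathbb{R}$ of nonzero norm and a root of unity $\xi\ne1$, the $\xi$-reflection in $r$ is $v\mapsto v-r(1-\xi)\langle r|v\rangle/r^2$.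 $\mathrm{Reflec}\,L$ is the subgroup of $\mathrm{Aut}\,L$ generated by those elements of $\mathrm{Aut}\,L$ that are reflections in positive-norm vectors. $\mathrm{Reflec}_0\,L$ is the subgroup generated by the reflections ($\xi$-reflections for units $\xi$ of $\mathcal{E}$) in the short roots of $L$, i.e. the norm $1$ vectors of $L$. $I$ is the identity. *)

(* Defs.v *)
From HB Require Import structures.
From mathcomp Require Import all_boot all_order all_algebra.
From mathcomp Require Import ring lra.
From mathcomp Require Import boolp classical_sets functions cardinality reals.
From mathcomp Require Import complex.

Set Implicit Arguments.
Unset Strict Implicit.
Unset Printing Implicit Defensive.

Import Order.TTheory GRing.Theory Num.Theory.

Local Open Scope classical_set_scope.
Local Open Scope ring_scope.

(* [Eis a b] stands for a + b omega, with omega ^ 2 = - 1 - omega and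
   conj omega = - 1 - omega. *)
Record eisenstein : Type := Eis { eisA : int; eisB : int }.
Notation E := eisenstein.

Definition eis_pair (x : E) := (eisA x, eisB x).
Definition pair_eis (p : int * int) := Eis p.1 p.2.
Lemma eis_pairK : cancel eis_pair pair_eis. Proof. by case. Qed.

HB.instance Definition _ := Choice.copy E (can_type eis_pairK).

Definition eis_zero := Eis 0 0.
Definition eis_one := Eis 1 0.
Definition eis_opp (x : E) := Eis (- eisA x) (- eisB x).
Definition eis_add (x y : E) := Eis (eisA x + eisA y) (eisB x + eisB y).
Definition eis_mul (x y : E) :=
  Eis (eisA x * eisA y - eisB x * eisB y)
      (eisA x * eisB y + eisB x * eisA y - eisB x * eisB y).
Definition eis_conj (x : E) := Eis (eisA x - eisB x) (- eisB x).
Definition eis_norm (x : E) : int :=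
  eisA x ^+ 2 - eisA x * eisB x + eisB x ^+ 2.

Lemma eis_addA : associative eis_add.
Proof. by move=> [a b] [c d] [e f]; congr Eis => /=; ring. Qed.
Lemma eis_addC : commutative eis_add.
Proof. by move=> [a b] [c d]; congr Eis => /=; ring. Qed.
Lemma eis_add0 : left_id eis_zero eis_add.
Proof. by move=> [a b]; congr Eis => /=; ring. Qed.
Lemma eis_addN : left_inverse eis_zero eis_opp eis_add.
Proof. by move=> [a b]; congr Eis => /=; ring. Qed.

HB.instance Definition _ :=
  GRing.isZmodule.Build E eis_addA eis_addC eis_add0 eis_addN.

Lemma eis_mulA : associative eis_mul.
Proof. by move=> [a b] [c d] [e f]; congr Eis => /=; ring. Qed.
Lemma eis_mulC : commutative eis_mul.
Proof. by move=> [a b] [c d]; congr Eis => /=; ring. Qed.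
Lemma eis_mul1 : left_id eis_one eis_mul.
Proof. by move=> [a b]; congr Eis => /=; ring. Qed.
Lemma eis_mulDl : left_distributive eis_mul eis_add.
Proof. by move=> [a b] [c d] [e f]; congr Eis => /=; ring. Qed.
Lemma eis_one_neq0 : eis_one != eis_zero. Proof. by []. Qed.

HB.instance Definition _ :=
  GRing.Zmodule_isComNzRing.Build E eis_mulA eis_mulC eis_mul1 eis_mulDl
    eis_one_neq0.

Lemma eis_normM x y : eis_norm (x * y) = eis_norm x * eis_norm y.
Proof. by case: x y => [a b] [c d]; rewrite /eis_norm /=; ring. Qed.

Lemma eis_norm_ge0 x : 0 <= eis_norm x.
Proof.
case: x => a b; rewrite /eis_norm /=.
by have := sqr_ge0 (2 * a - b); have := sqr_ge0 b; nra.
Qed.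

Lemma eis_mul_conj x : eis_conj x * x = Eis (eis_norm x) 0.
Proof. by case: x => a b; congr Eis; rewrite /= /eis_norm /=; ring. Qed.

Definition eis_unit : {pred E} := fun x => eis_norm x == 1.
Definition eis_inv (x : E) := if eis_unit x then eis_conj x else x.

Lemma eis_mulV : {in eis_unit, left_inverse 1 eis_inv *%R}.
Proof.
move=> x ux; rewrite /eis_inv (ux : eis_unit x) eis_mul_conj.
by rewrite (eqP (ux : eis_norm x == 1)).
Qed.

Lemma eis_unitPl (x y : E) : y * x = 1 -> eis_unit x.
Proof.
move=> yx; have := eis_normM y x; rewrite yx => /esym nyx.
rewrite /eis_unit; have := eis_norm_ge0 x; have := eis_norm_ge0 y.
move: nyx; case: (eis_norm x) => // m; case: (eis_norm y) => // k.
by move=> [/eqP]; rewrite muln_eq1 => /andP[_ /eqP ->].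
Qed.

Lemma eis_inv_out : {in [predC eis_unit], eis_inv =1 id}.
Proof. by move=> x /negbTE ux; rewrite /eis_inv (ux : eis_unit x = false). Qed.

HB.instance Definition _ :=
  GRing.ComNzRing_hasMulInverse.Build E eis_mulV eis_unitPl eis_inv_out.

Lemma eis_conj_is_zmod_morphism : zmod_morphism eis_conj.
Proof. by move=> [a b] [c d]; congr Eis => /=; ring. Qed.
Lemma eis_conj_is_monoid_morphism : monoid_morphism eis_conj.
Proof. by split=> // -[a b] [c d]; congr Eis => /=; ring. Qed.

HB.instance Definition _ :=
  GRing.isZmodMorphism.Build E E eis_conj eis_conj_is_zmod_morphism.
HB.instance Definition _ :=
  GRing.isMonoidMorphism.Build E E eis_conj eis_conj_is_monoid_morphism.

Section Embedding.
Variable R : realType.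

Definition omegaC : R[i] := Complex (- 1) (Num.sqrt 3) / 2.

Definition eisC (x : E) : R[i] := (eisA x)%:~R + (eisB x)%:~R * omegaC.

Lemma omegaCE : omegaC = Complex (- (2^-1)) (Num.sqrt 3 / 2).
Proof.
apply: (@mulIf _ (2 : R[i])); first by rewrite pnatr_eq0.
rewrite /omegaC mulfVK ?pnatr_eq0 //; have -> : 2 = Complex 2 0 :> R[i].
  by rewrite -(rmorph_nat (real_complex R)).
by apply/eqP; rewrite eq_complex /=; apply/andP; split; apply/eqP; field.
Qed.

Lemma omegaC_sqr : omegaC ^+ 2 = - 1 - omegaC.
Proof.
have s3 : Num.sqrt (3 : R) * Num.sqrt 3 = 3 by rewrite -expr2 sqr_sqrtr.
rewrite omegaCE expr2; apply/eqP; rewrite eq_complex /=.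
apply/andP; split; apply/eqP; last by field.
rewrite mulrACA s3; by field.
Qed.

Lemma conj_omegaC : conjc omegaC = - 1 - omegaC.
Proof.
rewrite omegaCE; apply/eqP; rewrite eq_complex /=.
by apply/andP; split; apply/eqP; field.
Qed.

Lemma eisC_is_zmod_morphism : zmod_morphism eisC.
Proof. by move=> [a b] [c d]; rewrite /eisC /= !rmorphD !rmorphN /=; ring. Qed.

Lemma eisC_is_monoid_morphism : monoid_morphism eisC.
Proof.
split; first by rewrite /eisC /= mul0r addr0.
move=> [a b] [c d]; rewrite /eisC /= !(rmorphD, rmorphN, rmorphM) /=.
ring: omegaC_sqr.
Qed.

HB.instance Definition _ :=
  GRing.isZmodMorphism.Build E R[i] eisC eisC_is_zmod_morphism.
HB.instance Definition _ :=
  GRing.isMonoidMorphism.Build E R[i] eisC eisC_is_monoid_morphism.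

Lemma eisC_conj x : eisC (eis_conj x) = conjc (eisC x).
Proof.
have intK k : conjc k%:~R = k%:~R :> R[i] by apply: (rmorph_int (@conjc R)).
case: x => a b; rewrite /eisC.
have -> : forall u v w : R[i], conjc (u + v * w) = conjc u + conjc v * conjc w.
  by move=> u v w; rewrite -(rmorphM (@conjc R)) -(rmorphD (@conjc R)).
by rewrite !intK conj_omegaC /= rmorphB rmorphN; ring.
Qed.

Lemma eisC_inj : injective eisC.
Proof.
apply: raddf_inj => -[a b] /=; rewrite /eisC omegaCE => /eqP.
have intC k : k%:~R = Complex k%:~R 0 :> R[i].
  by rewrite -(rmorph_int (real_complex R)).
rewrite !intC eq_complex /= => /andP[/eqP re /eqP im].
have s3 : Num.sqrt 3 / 2 != 0 :> R.
  by rewrite mulf_neq0 ?invr_neq0 ?pnatr_eq0 // lt0r_neq0 ?sqrtr_gt0.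
move: im; rewrite mul0r addr0 add0r => /eqP; rewrite mulf_eq0 (negbTE s3) orbF.
rewrite intr_eq0 => /eqP b0; move: re; rewrite b0 !mul0r subr0 addr0 => /eqP.
by rewrite intr_eq0 => /eqP ->.
Qed.

End Embedding.

Section Forms.
Variables (A : comUnitRingType) (cj : A -> A) (m : nat) (G : 'M[A]_m).

(* Conjugate-linear in the first variable, with inner product matrix G. *)
Definition herm (x y : 'cV[A]_m) : A := ((map_mx cj x)^T *m G *m y) 0 0.

Definition reflection (xi : A) (r v : 'cV[A]_m) : 'cV[A]_m :=
  v - ((1 - xi) * herm r v / herm r r) *: r.

End Forms.

Section Groups.
Variable m : nat.
Implicit Types (S H K : set 'M[E]_m) (X : set 'cV[E]_m).

Inductive generated S : set 'M[E]_m :=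
| gen_in g of S g : generated S g
| gen_1 : generated S 1%:M
| gen_mul g h of generated S g & generated S h : generated S (g *m h)
| gen_inv g of generated S g : generated S (invmx g).

Definition lat_orbit H (v : 'cV[E]_m) : set 'cV[E]_m := [set g *m v | g in H].

Definition lat_orbits H X : set (set 'cV[E]_m) := [set lat_orbit H v | v in X].

Definition transitive_on H X :=
  forall v w, X v -> X w -> exists2 g, H g & g *m v = w.

Definition internal_direct_product K H1 H2 :=
  [/\ K = [set g *m h | g in H1 & h in H2],
      H1 `&` H2 = [set 1%:M]
    & forall g h, H1 g -> H2 h -> g *m h = h *m g].

End Groups.

(* The lattice is E^m with the Hermitian form of inner product matrix G; its
   E-linear endomorphisms are identified with their matrices, acting on column
   vectors, and its tensor product with the reals is C^m. *)
Section Lattices.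
Variables (m : nat) (G : 'M[E]_m).

Definition herm_lat : 'cV[E]_m -> 'cV[E]_m -> E := herm eis_conj G.

Definition primitive (v : 'cV[E]_m) :=
  v != 0 /\
  forall (w : 'cV[E]_m) (a : E), v = a *: w -> a \is a GRing.unit.

Definition primitive_null : set 'cV[E]_m :=
  [set v | primitive v /\ herm_lat v v = 0].

Definition Aut_lat : set 'M[E]_m :=
  [set g | g \in unitmx /\
           forall x y, herm_lat (g *m x) (g *m y) = herm_lat x y].

Definition positive_reflection (R : realType) : set 'M[E]_m :=
  [set g | exists (xi : R[i]) (r : 'cV[R[i]]_m),
     [/\ xi != 1, exists2 k, (0 < k)%N & k.-unity_root xi,
         0 < herm (@conjc R) (map_mx (@eisC R) G) r r
       & forall v : 'cV[R[i]]_m, map_mx (@eisC R) g *m v =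
           reflection (@conjc R) (map_mx (@eisC R) G) xi r v]].

Definition Reflec (R : realType) : set 'M[E]_m :=
  generated (Aut_lat `&` positive_reflection R).

Definition short_reflection : set 'M[E]_m :=
  [set g | exists (xi : E) (r : 'cV[E]_m),
     [/\ xi != 1, xi \is a GRing.unit, herm_lat r r = 1
       & forall v : 'cV[E]_m, g *m v = reflection eis_conj G xi r v]].

Definition Reflec0 : set 'M[E]_m := generated short_reflection.

End Lattices.

Definition II11 : 'M[E]_(1 + 1) := block_mx 0 1%:M 1%:M 0.

Definition lat_L (n : nat) : 'M[E]_(n + (1 + 1)) := block_mx 1%:M 0 0 II11.

Definition vec_L n (lam : 'cV[E]_n) (mu nu : E) : 'cV[E]_(n + (1 + 1)) :=
  col_mx lam (col_mx mu%:M nu%:M).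

Definition rho n : 'cV[E]_(n + (1 + 1)) := vec_L 0 0 1.

(* Main.v *)
Require Import Defs.
From HB Require Import structures.
From mathcomp Require Import all_boot all_order all_algebra.
From mathcomp Require Import ring lra zify.
From mathcomp Require Import boolp classical_sets functions cardinality reals.
From mathcomp Require Import complex.

Set Implicit Arguments.
Unset Strict Implicit.
Unset Printing Implicit Defensive.

Import Order.TTheory GRing.Theory Num.Theory.

Local Open Scope classical_set_scope.
Local Open Scope card_scope.
Local Open Scope ring_scope.

(** Write L as Lambda + II_{1,1}, with vectors vec_L l mu nu, and let rho and
    corho be the two null basis vectors of II_{1,1}.

    Every primitive null vector can be moved to rho or - rho by reflections
    in short roots. The height of v = (l; mu, nu) is the norm of mu = <rho |
    v>. If mu is not 0, a short root r = (q; 1, c) with q close to l / mu and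
    a suitable c gives a number a = <r | v> / mu with 0 <= Re a <= 1/2 and
    |Im a| <= sqrt 3 / 2, and a reflection of order 6 in r lowers the height
    as soon as a is not 0 ([root_above]). The covering radius of E^n is sqrt
    (n / 3), so that for n <= 3 a vanishing a forces n = 3 and forces l / mu
    to be a deep hole; another lattice point at the same distance then works
    ([descent_step]). At height 0 the vector is a unit multiple of rho, and
    rho is equivalent to omega rho ([orbit_rho]).

    The stabilizer of rho in Aut L is handled in the same style. Reflections
    in short roots orthogonal to rho carry any null vector w with <rho | w> =
    1 to corho ([orbit_height1]); what remains acts on Lambda by a monomial
    matrix, hence is a product of short reflections and of transpositions of
    coordinates ([fix_hyperbolic_plane]). A transposition is a reflection in
    a vector of norm 2; its negative is a product of short reflections
    ([neg_swap_Reflec0]), which also gives rho ~ - rho for n >= 2. Hence Aut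
    L is the union of Reflec0 L and - Reflec0 L ([Aut_latE]).

    It remains to see that - I is not in Reflec0 L. The invariant is the
    spinor norm of the action on L / theta L, a quadratic space over F_3 in
    which short reflections become trivial or reflections in vectors of norm
    1. It is
    computed through an explicit action of a Clifford algebra on a
    4-dimensional symplectic space of spinors: each element of Reflec0 lifts
    to an operator which transforms the Clifford action and the symplectic
    form with the same sign ([spin_Reflec0]), whereas - I and the reflections
    in vectors of norm 2 have lifts with opposite signs, and no isometry has
    lifts of both kinds ([not_spin_cospin]). This is done for n = 3, and
    smaller n are padded. For n = 1 it separates the orbits of rho and - rho;
    in general it shows that the norm 2 reflection is minus an element of
    Reflec0, so that - I is a product of reflections. *)

(** * Arithmetic of the Eisenstein integers *)

Definition omega : E := Eis 0 1.

Lemma omega_sqr : omega ^+ 2 = - 1 - omega. Proof. by []. Qed.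

Lemma conj_omega : eis_conj omega = - 1 - omega. Proof. by []. Qed.

Lemma eis_conjK : involutive eis_conj.
Proof. by case=> a b; congr Eis => /=; ring. Qed.

Lemma eis_norm_conj x : eis_norm (eis_conj x) = eis_norm x.
Proof. by case: x => a b; rewrite /eis_norm /=; ring. Qed.

Lemma eis_norm_eq0 x : (eis_norm x == 0) = (x == 0).
Proof.
apply/eqP/eqP=> [|->//]; case: x => a b; rewrite /eis_norm /= => h.
have b0 : b = 0 by nia.
by rewrite b0; congr Eis; subst b; nia.
Qed.

Lemma eis_norm_gt0 x : x != 0 -> 0 < eis_norm x.
Proof. by rewrite lt_def eis_norm_ge0 eis_norm_eq0 andbT. Qed.

Lemma eis_intr (k : int) : k%:~R = Eis k 0.
Proof.
have nat_case m : (m%:R : E) = Eis m%:Z 0.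
  by elim: m => // m IH; rewrite mulrS IH; congr Eis => /=; lia.
case: k => m; first exact: nat_case.
by rewrite NegzE rmorphN /= -[(_.+1)%:~R]/(_.+1%:R) nat_case.
Qed.

Lemma eis_conjM x : eis_conj x * x = (eis_norm x)%:~R.
Proof. by rewrite eis_mul_conj eis_intr. Qed.

Lemma eis_unit_conj u : u \is a GRing.unit -> eis_conj u * u = 1.
Proof. by move=> /eqP uu; rewrite eis_mul_conj uu. Qed.

(** A point of an equilateral triangle of side a + b + c with barycentric
    coordinates a, b, c is at squared distance b ^ 2 + b c + c ^ 2 from the
    vertex with coordinate a. The vertex of largest coordinate is at squared
    distance less than a third of the squared side, except for the centre. *)
Lemma barycentric (a b c : int) : 0 <= b <= a -> 0 <= c <= a ->
  3 * (b ^+ 2 + b * c + c ^+ 2) < (a + b + c) ^+ 2 \/ b = a /\ c = a.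
Proof. 
move=> /andP[b0 ba] /andP[c0 ca].
case: (eqVneq b a) => [->|nba]. 
  case: (eqVneq c a) => [->|nca]; first by right. 
  left; nia.
left; nia.
Qed.

Lemma triangle (a b c : int) : 0 <= a -> 0 <= b -> 0 <= c ->
  let D := a + b + c in
  [\/ 3 * (b ^+ 2 + b * c + c ^+ 2) < D ^+ 2,
      3 * (c ^+ 2 + c * a + a ^+ 2) < D ^+ 2,
      3 * (a ^+ 2 + a * b + b ^+ 2) < D ^+ 2 | a = b /\ a = c].
Proof.
move=> a0 b0 c0 D; rewrite {}/D.
have Ha : b <= a -> c <= a -> _ := fun h k =>
  @barycentric a b c (introT andP (conj b0 h)) (introT andP (conj c0 k)).
have Hb : c <= b -> a <= b -> _ := fun h k =>
  @barycentric b c a (introT andP (conj c0 h)) (introT andP (conj a0 k)).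
have Hc : a <= c -> b <= c -> _ := fun h k =>
  @barycentric c a b (introT andP (conj a0 h)) (introT andP (conj b0 k)).
have [ba|ab] := leP b a; have [ca|ac] := leP c a.
- by case: (Ha ba ca) => [?|[-> ->]]; [constructor 1|constructor 4].
- by case: Hc => [||?|[? ?]]; [lia|lia|constructor 3|]; lia.
- by case: Hb => [||?|[? ?]]; [lia|lia|constructor 2|]; lia.
have [cb|bc] := leP c b.
- by case: Hb => [||?|[? ?]]; [lia|lia|constructor 2|]; lia.
- by case: Hc => [||?|[? ?]]; [lia|lia|constructor 3|]; lia.
Qed.

(** The Eisenstein lattice scaled by D cuts the plane into equilateral
    triangles, so [triangle] applies to the one that contains x + y omega.
    The exceptional points are the deep holes, which have several closest
    lattice points; two of these differ by a unit. *)
Lemma nearest_pair (D x y : int) : 0 < D ->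
  exists q : E, let f (p : E) := eis_norm (Eis x y - p * Eis D 0) in
  3 * f q < D ^+ 2 \/
  [/\ 3 * f q = D ^+ 2, forall b, Eis x y <> b * Eis D 0
    & exists q', 3 * f q' = D ^+ 2 /\ q' - q \is a GRing.unit].
Proof.
move=> D0.
have [x0 [s [-> s0 sD]]] : exists x0 s, [/\ x = x0 * D + s, 0 <= s & s < D].
  exists (x %/ D)%Z, (x %% D)%Z; split; first exact: divz_eq.
    exact: modz_ge0 (lt0r_neq0 D0).
  exact: ltz_pmod.
have [y0 [t [-> t0 tD]]] : exists y0 t, [/\ y = y0 * D + t, 0 <= t & t < D].
  exists (y %/ D)%Z, (y %% D)%Z; split; first exact: divz_eq.
    exact: modz_ge0 (lt0r_neq0 D0).
  exact: ltz_pmod.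
have normE (i j : int) :
    eis_norm (Eis (x0 * D + s) (y0 * D + t) - Eis (x0 + i) (y0 + j) * Eis D 0)
    = (s - i * D) ^+ 2 - (s - i * D) * (t - j * D) + (t - j * D) ^+ 2.
  by rewrite /eis_norm /=; ring.
have [ts|st] := leP t s.
  have [||||||[Da Db]] := @triangle (D - s) (s - t) t; try lia.
  - by exists (Eis (x0 + 0) (y0 + 0)); left; rewrite normE; lia.
  - by exists (Eis (x0 + 1) (y0 + 0)); left; rewrite normE; lia.
  - by exists (Eis (x0 + 1) (y0 + 1)); left; rewrite normE; lia.
  exists (Eis (x0 + 0) (y0 + 0)); right; split; first by rewrite normE; lia.
    case=> b1 b2 [] e _; have /eqP : t * (3 * (b1 - x0) - 2) = 0 by nia.
    by rewrite mulf_eq0; lia.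
  exists (Eis (x0 + 1) (y0 + 0)); split; first by rewrite normE; lia.
  by rewrite [_ - _](_ : _ = 1) //; congr Eis => /=; ring.
have [||||||[Da Db]] := @triangle (D - t) (t - s) s; try lia.
- by exists (Eis (x0 + 0) (y0 + 0)); left; rewrite normE; lia.
- by exists (Eis (x0 + 0) (y0 + 1)); left; rewrite normE; lia.
- by exists (Eis (x0 + 1) (y0 + 1)); left; rewrite normE; lia.
exists (Eis (x0 + 0) (y0 + 0)); right; split; first by rewrite normE; lia.
  case=> b1 b2 [] e _; have /eqP : s * (3 * (b1 - x0) - 1) = 0 by nia.
  by rewrite mulf_eq0; lia.
exists (Eis (x0 + 0) (y0 + 1)); split; first by rewrite normE; lia.
by rewrite [_ - _](_ : _ = omega) //; congr Eis => /=; ring.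
Qed.

(** The previous lemma for a / m, after multiplication by the conjugate of m.
    Deep holes are kept as a separate case because the descent has to choose
    between the lattice points around them. *)
Lemma nearest (a m : E) : m != 0 ->
  exists q : E,
  3 * eis_norm (a - q * m) < eis_norm m \/
  [/\ 3 * eis_norm (a - q * m) = eis_norm m, forall b, a <> b * m
    & exists q', 3 * eis_norm (a - q' * m) = eis_norm m /\
                 q' - q \is a GRing.unit].
Proof.
move=> /eis_norm_gt0 D0; set D := eis_norm m in D0 *.
have mm : m * eis_conj m = Eis D 0 by rewrite mulrC eis_mul_conj.
case: (nearest_pair (eisA (a * eis_conj m)) (eisB (a * eis_conj m)) D0) => q.
have -> : Eis (eisA (a * eis_conj m)) (eisB (a * eis_conj m)) = a * eis_conj m.
  by case: (a * _).
have fE p : eis_norm (a * eis_conj m - p * Eis D 0) = eis_norm (a - p * m) * D.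
  by rewrite -mm mulrA -mulrBl eis_normM eis_norm_conj.
have cancelD k : 3 * (k * D) = D ^+ 2 -> 3 * k = D.
  by rewrite mulrA expr2 => /(mulIf (lt0r_neq0 D0)).
move=> /= H; exists q; move: H.
rewrite fE => -[h|[h nd [q' [h' u]]]]; [left|right].
  by move: h; rewrite mulrA expr2 ltr_pM2r.
split; first exact: cancelD.
  by move=> b ab; apply: (nd b); rewrite ab -mm mulrA.
by exists q'; split => //; apply: cancelD; rewrite -fE.
Qed.

(** * Hermitian lattices and pseudo-reflections *)

(** The coefficient c is 1 - xi for short roots; other values give the
    reflections in longer roots. It is locked, so that reflections are
    compared by their roots. *)
HB.lock Definition refl m (G : 'M[E]_m) (c : E) (r : 'cV[E]_m) : 'M[E]_m :=
  1%:M - c *: (r *m ((map_mx eis_conj r)^T *m G)).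

Section GeneralLattice.
Variables (m : nat) (G : 'M[E]_m).
Local Notation "<[ x | y ]>" := (herm_lat G x y).
Implicit Types (x y v r : 'cV[E]_m) (g h : 'M[E]_m).

Lemma herm_latDr x y z : <[x | y + z]> = <[x | y]> + <[x | z]>.
Proof. by rewrite /herm_lat /herm mulmxDr mxE. Qed.

Lemma herm_latZr a x y : <[x | a *: y]> = a * <[x | y]>.
Proof. by rewrite /herm_lat /herm -scalemxAr mxE. Qed.

Lemma herm_latDl x y z : <[x + y | z]> = <[x | z]> + <[y | z]>.
Proof. by rewrite /herm_lat /herm map_mxD linearD /= !mulmxDl mxE. Qed.

Lemma herm_latZl a x y : <[a *: x | y]> = eis_conj a * <[x | y]>.
Proof.
by rewrite /herm_lat /herm map_mxZ linearZ /= -!scalemxAl mxE.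
Qed.

Lemma herm_latNr x y : <[x | - y]> = - <[x | y]>.
Proof. by rewrite -scaleN1r herm_latZr mulN1r. Qed.

Lemma herm_latNl x y : <[- x | y]> = - <[x | y]>.
Proof. by rewrite -scaleN1r herm_latZl rmorphN1 mulN1r. Qed.

Local Notation refl := (refl G).

Lemma reflE c r v : refl c r *m v = v - (c * <[r | v]>) *: r.
Proof.
rewrite unlock mulmxBl mul1mx -scalemxAl -mulmxA [_ *m v]mx11_scalar.
by rewrite mul_mx_scalar scalerA.
Qed.

Lemma reflN c r : refl c (- r) = refl c r.
Proof.
have conjN : (map_mx eis_conj (- r))^T = - (map_mx eis_conj r)^T.
  by rewrite map_mxN linearN.
by rewrite unlock conjN !mulNmx mulmxN opprK.
Qed.

Lemma eq_mulmx g h : (forall v, g *m v = h *m v) -> g = h.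
Proof.
move=> gh; rewrite -[g]mulmx1 -[h]mulmx1; apply/matrixP => i j.
have /matrixP/(_ i 0) := gh (col j 1%:M).
by rewrite !colE !mulmxA -!colE !mxE.
Qed.

Lemma short_reflectionE g :
  short_reflection G g <->
  exists xi r, [/\ xi != 1, xi \is a GRing.unit, <[r | r]> = 1
                 & g = refl (1 - xi) r].
Proof.
split=> -[xi [r [xi1 u rr gE]]]; exists xi, r; split => //.
  apply: eq_mulmx => v.
  by rewrite gE /reflection -/(herm_lat G r r) rr divr1 reflE.
by move=> v; rewrite gE /reflection -/(herm_lat G r r) rr divr1 reflE.
Qed.

Lemma refl_Reflec0 xi r : xi \is a GRing.unit -> <[r | r]> = 1 ->
  Reflec0 G (refl (1 - xi) r).
Proof.
move=> u rr; have [->|xi1] := eqVneq xi 1.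
  by rewrite unlock subrr scale0r subr0; apply: gen_1.
by apply: gen_in; apply/short_reflectionE; exists xi, r.
Qed.

Hypothesis G_herm : (map_mx eis_conj G)^T = G.
Hypothesis G_unimod : G *m G = 1%:M.

Lemma herm_latC x y : <[y | x]> = eis_conj <[x | y]>.
Proof.
have conj2 k l (A : 'M[E]_(k, l)) : map_mx eis_conj (map_mx eis_conj A) = A.
  by apply/matrixP => i j; rewrite !mxE eis_conjK.
rewrite /herm_lat /herm; set M := _ *m _ *m y.
have <- : (map_mx eis_conj M)^T 0 0 = eis_conj (M 0 0) by rewrite !mxE.
rewrite /M !map_mxM !trmx_mul -map_trmx trmxK conj2 G_herm mulmxA; reflexivity.
Qed.

(** The adjoint of an isometry of a unimodular form is its inverse. *)
Lemma isometry_Aut g :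
  (forall x y, <[g *m x | g *m y]> = <[x | y]>) -> Aut_lat G g.
Proof.
move=> gG; split=> //.
have gGg : (map_mx eis_conj g)^T *m G *m g = G.
  apply/matrixP => i j; have := gG (delta_mx i 0) (delta_mx j 0).
  rewrite /herm_lat /herm !map_mxM !trmx_mul !map_delta_mx !trmx_delta !mulmxA.
  by rewrite -!colE mxE [RHS]mxE -!mulmxA -!rowE mxE [RHS]mxE !mulmxA.
suff : (G *m (map_mx eis_conj g)^T *m G) *m g = 1%:M by move/mulmx1_unit => [].
by rewrite -!mulmxA [X in G *m X](_ : _ = G) // mulmxA.
Qed.

(** This covers both c = 1 - xi for a root of norm 1 and c = 1 for a root of
    norm 2. *)
Lemma refl_Aut c r : eis_conj c * c * <[r | r]> = c + eis_conj c ->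
  Aut_lat G (refl c r).
Proof.
move=> cr; apply: isometry_Aut => x y; rewrite !reflE.
rewrite !(herm_latDl, herm_latDr, herm_latNl, herm_latNr).
rewrite !(herm_latZl, herm_latZr).
rewrite (herm_latC r x) rmorphM.
set a := <[r | x]>; set b := <[r | y]>; set k := <[r | r]> in cr *.
rewrite -[RHS]addr0 -(mulr0 (eis_conj a * b)) -(subrr (c + eis_conj c)) -{1}cr.
ring.
Qed.

Lemma Aut_lat1 : Aut_lat G 1%:M.
Proof. by split=> [|x y]; rewrite ?unitmx1 ?mul1mx. Qed.

Lemma Aut_latM g h : Aut_lat G g -> Aut_lat G h -> Aut_lat G (g *m h).
Proof.
move=> [ug gG] [uh hG]; split=> [|x y]; first by rewrite unitmx_mul ug.
by rewrite -!mulmxA gG hG.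
Qed.

Lemma Aut_latV g : Aut_lat G g -> Aut_lat G (invmx g).
Proof.
move=> [ug gG]; split=> [|x y]; first by rewrite unitmx_inv.
by rewrite -gG !mulKVmx.
Qed.

Lemma Aut_latN g : Aut_lat G g -> Aut_lat G (- g).
Proof.
move=> [ug gG]; split=> [|x y].
  by rewrite -scaleN1r unitmxZ // unitrN1.
by rewrite !mulNmx herm_latNl herm_latNr opprK.
Qed.

Lemma generated_Aut S : S `<=` Aut_lat G -> generated S `<=` Aut_lat G.
Proof.
move=> SA g; elim=> [{}g|| {}g h _ + _|{}g _]; 
  [exact: SA|exact: Aut_lat1|exact: Aut_latM|exact: Aut_latV].
Qed.

End GeneralLattice.

(** * The lattice L in coordinates *)

Notation "<[ x | y ]>" := (herm_lat (lat_L _) x y).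

Section LatticeL.
Variable n : nat.
Implicit Types (l : 'cV[E]_n) (a b c mu nu : E) (v w : 'cV[E]_(n + (1 + 1))).

Lemma lat_L_herm : (map_mx eis_conj (lat_L n))^T = lat_L n.
Proof.
rewrite /lat_L /II11 !map_block_mx !tr_block_mx !map_mx0 !trmx0.
by rewrite !map_scalar_mx !tr_scalar_mx !rmorph1.
Qed.

Lemma lat_L_unimod : lat_L n *m lat_L n = 1%:M.
Proof.
rewrite /lat_L /II11 !mulmx_block !mul0mx !mulmx0 !mul1mx !addr0 !add0r.
by rewrite -!scalar_mx_block.
Qed.

Definition hdot l l' : E := \sum_i eis_conj (l i 0) * l' i 0.

Lemma herm_vec_L l mu nu l' mu' nu' :
  <[vec_L l mu nu | vec_L l' mu' nu']> =
  hdot l l' + eis_conj mu * nu' + eis_conj nu * mu'.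
Proof.
rewrite /herm_lat /herm /vec_L /lat_L /II11 !map_col_mx !tr_col_mx -!mulmxA.
rewrite !mul_block_col !mul_row_col !mul0mx !mul1mx !addr0 !add0r.
rewrite !mul_row_col !map_scalar_mx !tr_scalar_mx -!scalar_mxM !mxE /=.
rewrite !mulr1n addrA.
congr (_ + _ + _).
by apply: eq_bigr => i _; rewrite !mxE.
Qed.

Lemma vec_LP v : exists l mu nu, v = vec_L l mu nu.
Proof.
exists (usubmx v), (usubmx (dsubmx v) 0 0), (dsubmx (dsubmx v) 0 0).
by rewrite /vec_L -!mx11_scalar !vsubmxK.
Qed.

Lemma vec_L_inj l mu nu l' mu' nu' : vec_L l mu nu = vec_L l' mu' nu' ->
  [/\ l = l', mu = mu' & nu = nu'].
Proof.
move=> /eq_col_mx[-> /eq_col_mx[/matrixP/(_ 0 0) + /matrixP/(_ 0 0)]].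
by rewrite !mxE /= !mulr1n.
Qed.

Lemma vec_LD l mu nu l' mu' nu' :
  vec_L l mu nu + vec_L l' mu' nu' = vec_L (l + l') (mu + mu') (nu + nu').
Proof. by rewrite /vec_L !add_col_mx -!raddfD. Qed.

Lemma vec_LZ a l mu nu : a *: vec_L l mu nu = vec_L (a *: l) (a * mu) (a * nu).
Proof. by rewrite /vec_L !scale_col_mx -!scale_scalar_mx. Qed.

Lemma vec_LN l mu nu : - vec_L l mu nu = vec_L (- l) (- mu) (- nu).
Proof. by rewrite -scaleN1r vec_LZ scaleN1r !mulN1r. Qed.

Lemma vec_LB l mu nu l' mu' nu' :
  vec_L l mu nu - vec_L l' mu' nu' = vec_L (l - l') (mu - mu') (nu - nu').
Proof. by rewrite vec_LN vec_LD. Qed.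

Lemma hdotC l l' : hdot l' l = eis_conj (hdot l l').
Proof.
rewrite /hdot rmorph_sum; apply: eq_bigr => i _.
by rewrite rmorphM /= eis_conjK mulrC.
Qed.

Lemma hdotDr l l1 l2 : hdot l (l1 + l2) = hdot l l1 + hdot l l2.
Proof.
by rewrite /hdot -big_split; apply: eq_bigr => i _; rewrite mxE mulrDr.
Qed.

Lemma hdotZr a l l' : hdot l (a *: l') = a * hdot l l'.
Proof.
by rewrite /hdot mulr_sumr; apply: eq_bigr => i _; rewrite mxE mulrCA.
Qed.

Lemma hdotDl l l1 l2 : hdot (l1 + l2) l = hdot l1 l + hdot l2 l.
Proof. by rewrite !(hdotC l) hdotDr rmorphD. Qed.

Lemma hdotZl a l l' : hdot (a *: l) l' = eis_conj a * hdot l l'.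
Proof. by rewrite hdotC hdotZr rmorphM /= -hdotC. Qed.

Lemma hdot0l l : hdot 0 l = 0.
Proof. by rewrite -(scale0r 0) hdotZl rmorph0 mul0r. Qed.

Lemma hdot0r l : hdot l 0 = 0.
Proof. by rewrite hdotC hdot0l rmorph0. Qed.

Lemma hdot_norm l : hdot l l = (\sum_i eis_norm (l i 0))%:~R.
Proof. by rewrite rmorph_sum; apply: eq_bigr => i _; rewrite eis_conjM. Qed.

Definition unitv i : 'cV[E]_n := delta_mx i 0.

Lemma hdot_unitvl i l : hdot (unitv i) l = l i 0.
Proof.
rewrite /hdot (bigD1 i) //= big1 => [|j /negbTE ji].
  by rewrite !mxE !eqxx rmorph1 mul1r addr0.
by rewrite !mxE ji rmorph0 mul0r.
Qed.

Lemma sum_norm_eq0 l : (\sum_i eis_norm (l i 0) = 0) -> l = 0.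
Proof.
move=> s0; apply/matrixP => i j; rewrite ord1 mxE; apply/eqP.
rewrite -eis_norm_eq0; move: s0 => /eqP.
rewrite psumr_eq0 => [/allP/(_ i)|k _]; last exact: eis_norm_ge0.
by rewrite mem_index_enum; apply.
Qed.

End LatticeL.

(** * Lowering the height of a null vector *)

Section Descent.
Variable n : nat.
Implicit Types (l : 'cV[E]_n) (a b c mu nu : E) (v w : 'cV[E]_(n + (1 + 1))).

Lemma reflLE c l mu nu l' mu' nu' :
  refl (lat_L n) c (vec_L l mu nu) *m vec_L l' mu' nu' =
  let d := c * (hdot l l' + eis_conj mu * nu' + eis_conj nu * mu') in
  vec_L (l' - d *: l) (mu' - d * mu) (nu' - d * nu).
Proof. by rewrite reflE herm_vec_L vec_LZ vec_LB. Qed.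

(** Twice the real part. *)
Definition eis_trace (x : E) : int := 2 * eisA x - eisB x.

Lemma eis_traceE x : x + eis_conj x = (eis_trace x)%:~R.
Proof.
by case: x => p q; rewrite eis_intr; congr Eis; rewrite /eis_trace /=; ring.
Qed.

(** With a = B / D the inequality says |1 - (1 - xi) a| < 1. For the two
    units xi of order 6, 1 - xi is a unit too, and this defines the open
    discs of radius 1 around exp (i pi / 3) and exp (- i pi / 3). Together
    they cover the rectangle 0 <= Re a <= 1/2, |Im a| <= sqrt 3 / 2 except
    for its point 0. *)
Lemma order6_discs_cover (D : int) (B : E) :
  0 < D -> 0 <= eis_trace B <= D -> `|eisB B| <= D -> B != 0 ->
  exists2 xi, xi \is a GRing.unit &
  eis_norm (D%:~R - (1 - xi) * B) < D ^+ 2.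
Proof.
case: B => p q D0; rewrite /eis_trace /= => /andP[X0 XD] qD B0.
have [q0|q0] := leP 0 q.
  exists (1 + omega) => //.
  rewrite eis_intr /eis_norm /=.
  have : ~ (p = 0 /\ q = 0) by move=> [? ?]; subst p q.
  set X := 2 * p - q in X0 XD.
  nia.
exists (- omega) => //.
have : ~ (p = 0 /\ q = 0) by lia.
rewrite eis_intr /eis_norm /=.
nia.
Qed.

Lemma eis_intr_inj : injective (fun k : int => k%:~R : E).
Proof. by move=> j k; rewrite !eis_intr => -[]. Qed.

(** The elements of given trace form a coset of theta Z, on which the
    omega-coordinate moves in steps of 2. *)
Lemma shift_center (D k y : int) : 0 < D ->
  exists2 c : E, eis_trace c = k & `|y - eisB c * D| <= D.
Proof.
move=> D0; set z := y + k * D.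
have zE := divz_eq z (2 * D).
have r0 : 0 <= (z %% (2 * D))%Z by apply: modz_ge0; lia.
have rD : (z %% (2 * D))%Z < 2 * D by apply: ltz_pmod; lia.
move: (z %/ _)%Z (z %% _)%Z zE r0 rD => j r zE r0 rD.
have [rle|rgt] := leP r D.
  exists (Eis j (2 * j - k)); rewrite /eis_trace /=; first ring.
  by rewrite /z in zE; lia.
exists (Eis (j + 1) (2 * (j + 1) - k)); rewrite /eis_trace /=; first ring.
by rewrite /z in zE; lia.
Qed.

(** For a = <r | v> / mu this is Re a = (1 - |l - lam / mu| ^ 2) / 2: the
    distance from lam / mu to l controls how far r is from being orthogonal
    to v. *)
Lemma tr_pairing l lam mu nu c :
  let r := vec_L l 1 c in let v := vec_L lam mu nu in
  <[r | r]> = 1 -> <[v | v]> = 0 ->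
  eis_trace (eis_conj mu * <[r | v]>) =
    eis_norm mu - \sum_i eis_norm (lam i 0 - l i 0 * mu).
Proof.
move=> r v; rewrite !herm_vec_L !rmorph1 !mul1r mulr1 => rr vv.
apply: eis_intr_inj; rewrite /= -eis_traceE rmorphB /= -eis_conjM.
have -> : \sum_i eis_norm (lam i 0 - l i 0 * mu)
    = \sum_i eis_norm ((lam + - mu *: l) i 0).
  by apply: eq_bigr => i _; rewrite !mxE; congr eis_norm; ring.
rewrite -hdot_norm !(hdotDl, hdotDr, hdotZl, hdotZr) (hdotC l lam).
set a := hdot l lam; set s := hdot l l in rr *; set t := hdot lam lam in vv *.
have -> : t = - (eis_conj mu * nu + eis_conj nu * mu).
  by apply/eqP; rewrite -subr_eq0 opprK addrA vv.
have -> : s = 1 - c - eis_conj c by rewrite -rr; ring.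
rewrite !(rmorphD, rmorphM, rmorphN) /= !eis_conjK; ring.
Qed.

(** The trace of c is dictated by <r | r> = 1. The remaining freedom is used
    to bring Im a into the range covered by the two discs. *)
Lemma root_above l lam mu nu : mu != 0 ->
  <[vec_L lam mu nu | vec_L lam mu nu]> = 0 ->
  \sum_i eis_norm (lam i 0 - l i 0 * mu) <= eis_norm mu ->
  exists c, let r := vec_L l 1 c in
  [/\ <[r | r]> = 1 & <[r | vec_L lam mu nu]> <> 0 ->
    exists2 xi, xi \is a GRing.unit &
    eis_norm (mu - (1 - xi) * <[r | vec_L lam mu nu]>) < eis_norm mu].
Proof.
move=> mu0 vv; set v := vec_L _ _ _ in vv *; set d := \sum_i _ => dle.
have D0 := eis_norm_gt0 mu0; set D := eis_norm mu in D0 dle *.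
pose k := 1 - \sum_i eis_norm (l i 0).
pose B0 := eis_conj mu * (hdot l lam + nu).
have [c trc yc] := shift_center k (eisB B0) D0.
have rr : <[vec_L l 1 c | vec_L l 1 c]> = 1.
  rewrite herm_vec_L rmorph1 mul1r mulr1 -addrA eis_traceE trc hdot_norm.
  by rewrite -rmorphD /k addrC subrK.
exists c; split; first exact: rr.
move=> /eqP A0; set A := <[_ | v]> in A0 *.
have := tr_pairing rr vv; rewrite -/A -/d -/D => trB.
have BE : eisB (eis_conj mu * A) = eisB B0 - eisB c * D.
  have -> : eis_conj mu * A = B0 + eis_conj c * D%:~R.
    by rewrite /A /v herm_vec_L rmorph1 mul1r -eis_conjM /B0; ring.
  by rewrite eis_intr /=; ring.
have B_neq0 : eis_conj mu * A != 0.
  rewrite -eis_norm_eq0 eis_normM eis_norm_conj mulf_neq0 ?eis_norm_eq0 //.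
have d0 : 0 <= d by apply: sumr_ge0 => i _; apply: eis_norm_ge0.
have [||xi u lt] := order6_discs_cover D0 _ _ B_neq0.
- by rewrite trB; lia.
- by rewrite BE.
exists xi => //; move: lt.
rewrite -eis_conjM mulrCA -mulrBr eis_normM eis_norm_conj -/D expr2.
by rewrite ltr_pM2l.
Qed.

(** When the root over the closest lattice point l is orthogonal to v, all
    the coordinates of lam / mu are deep holes. If the root over another
    closest point l', which differs from l by a unit in one coordinate, were
    orthogonal to v as well, the difference of the two conditions would make
    that coordinate of lam divisible by mu. *)
Lemma descent_step lam mu nu : (n <= 3)%N -> mu != 0 ->
  <[vec_L lam mu nu | vec_L lam mu nu]> = 0 ->
  exists xi r, [/\ xi \is a GRing.unit, <[r | r]> = 1 &
    exists lam' mu' nu',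
    refl (lat_L n) (1 - xi) r *m vec_L lam mu nu = vec_L lam' mu' nu' /\
    eis_norm mu' < eis_norm mu].
Proof.
move=> n3 mu0 vv; set D := eis_norm mu.
have D0 : 0 < D by apply: eis_norm_gt0.
suff [l [c [rr A0 dle]]] : exists l c, let r := vec_L l 1 c in
    [/\ <[r | r]> = 1, <[r | vec_L lam mu nu]> <> 0 &
     exists2 xi, xi \is a GRing.unit &
     eis_norm (mu - (1 - xi) * <[r | vec_L lam mu nu]>) < eis_norm mu].
  case: dle => xi u lt; exists xi, (vec_L l 1 c); split; [exact: u|exact: rr|].
  rewrite reflE vec_LZ vec_LB; do 3!eexists; split; first by [].
  by rewrite mulr1.
pose P i q := 3 * eis_norm (lam i 0 - q * mu) < D.
have /choice [f fP] i := nearest (lam i 0) mu0.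
pose l : 'cV[E]_n := \col_i f i.
have lE i : l i 0 = f i by rewrite mxE.
have le3 i : 3 * eis_norm (lam i 0 - l i 0 * mu) <= D.
  by rewrite lE; case: (fP i) => [/ltW//|[->]].
have sum_le (l' : 'cV[E]_n) :
    (forall i, 3 * eis_norm (lam i 0 - l' i 0 * mu) <= D) ->
    \sum_i eis_norm (lam i 0 - l' i 0 * mu) <= D.
  move=> h; suff : 3 * \sum_i eis_norm (lam i 0 - l' i 0 * mu) <= D * 3 by lia.
  rewrite mulr_sumr; apply: le_trans (_ : D *+ n <= _).
    by rewrite -[X in D *+ X]card_ord -sumr_const; apply: ler_sum.
  rewrite -[D *+ n]mulr_natr; apply: ler_wpM2l; first exact: ltW.
  by rewrite ler_nat.
have [c [rr dec]] := root_above mu0 vv (sum_le l le3).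
have [A0|nA0] := eqVneq <[vec_L l 1 c | vec_L lam mu nu]> 0; last first.
  by exists l, c; split=> //; [exact/eqP|apply: dec; exact/eqP].
have dD : \sum_i eis_norm (lam i 0 - l i 0 * mu) = D.
  by have := tr_pairing rr vv; rewrite A0 mulr0 /eis_trace /= -/D; lia.
have [i deep] : exists i, 3 * eis_norm (lam i 0 - l i 0 * mu) = D.
  apply: contrapT => /forallNP nd.
  have : \sum_i (3 * eis_norm (lam i 0 - l i 0 * mu)) <= \sum_(i < n) (D - 1).
    by apply: ler_sum => i _; have := le3 i; have := nd i; lia.
  rewrite -mulr_sumr dD sumr_const card_ord -mulr_natr; nia.
case: (fP i) => [|[_ ndiv [q' [q'd u]]]]; first by rewrite -lE -/D; lia.
pose l' : 'cV[E]_n := l + (q' - f i) *: unitv i.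
have l'E j : l' j 0 = if j == i then q' else l j 0.
  rewrite !mxE eqxx andbT; case: eqP => [->|_].
    by rewrite mulr1 addrC subrK.
  by rewrite mulr0 addr0.
have [|c' [rr' dec']] := @root_above l' lam mu nu mu0 vv.
  by apply: sum_le => j; rewrite l'E; case: eqP => // ->; rewrite q'd.
exists l', c'; suff nA' : <[vec_L l' 1 c' | vec_L lam mu nu]> <> 0.
  by split; [exact: rr'|exact: nA'|exact: dec'].
move: A0; rewrite !herm_vec_L rmorph1 !mul1r hdotDl hdotZl hdot_unitvl.
move=> A0 A0'.
set e := eis_conj (q' - f i) in A0'.
have ue : (q' - f i) * e = 1 by rewrite mulrC eis_unit_conj.
apply: (ndiv ((q' - f i) * (eis_conj c - eis_conj c'))).
rewrite -[lam i 0]mul1r -ue -!mulrA; congr (_ * _).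
apply/eqP; rewrite -subr_eq0; apply/eqP.
by rewrite -[RHS](subrr 0) -{1}A0' -A0; ring.
Qed.

End Descent.

(** * Groups of matrices and their orbits *)

Section MatrixGroups.
Variable m : nat.
Implicit Types (H : set 'M[E]_m) (v w : 'cV[E]_m).

Definition mxgroup H :=
  [/\ H 1%:M, forall g h, H g -> H h -> H (g *m h)
    & forall g, H g -> g \in unitmx /\ H (invmx g)].

Lemma generated_mxgroup S : (forall g, S g -> g \in unitmx) ->
  mxgroup (generated S).
Proof.
move=> Su; split=> [|g h|g gS]; [exact: gen_1|exact: gen_mul|].
split; last exact: gen_inv.
elim: gS => [{}g /Su//||{}g h _ ug _ uh|{}g _ ug]; first exact: unitmx1.
  by rewrite unitmx_mul ug.
by rewrite unitmx_inv.
Qed.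

Lemma generated_min S H : mxgroup H -> S `<=` H -> generated S `<=` H.
Proof.
move=> [H1 HM HV] SH g; elim=> [{}g /SH//|//|{}g h _ + _|{}g _ /HV[]//].
exact: HM.
Qed.

Definition fixator H v : set 'M[E]_m := [set g | H g /\ g *m v = v].

Lemma fixator_mxgroup H v : mxgroup H -> mxgroup (fixator H v).
Proof.
move=> [H1 HM HV]; split=> [|g h [Hg gv] [Hh hv]|g [Hg gv]].
- by split; rewrite ?mul1mx.
- by split; [exact: HM|rewrite -mulmxA hv].
have [ug HVg] := HV g Hg; split=> //; split=> //.
by rewrite -[in LHS]gv mulKmx.
Qed.

Section Orbits.
Variable H : set 'M[E]_m.
Hypothesis groupH : mxgroup H.

Lemma orbit_refl v : lat_orbit H v v.
Proof. by case: groupH => H1 _ _; exists 1%:M; rewrite ?mul1mx. Qed.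

Lemma orbit_trans v1 v2 v3 :
  lat_orbit H v1 v2 -> lat_orbit H v2 v3 -> lat_orbit H v1 v3.
Proof.
case: groupH => _ HM _ [g Hg <-] [h Hh <-].
by exists (h *m g); [exact: HM|rewrite mulmxA].
Qed.

Lemma orbit_sym v w : lat_orbit H v w -> lat_orbit H w v.
Proof.
case: groupH => _ _ HV [g Hg <-]; have [ug HVg] := HV g Hg.
by exists (invmx g); rewrite ?mulKmx.
Qed.

Lemma orbitZ a v w : lat_orbit H v w -> lat_orbit H (a *: v) (a *: w).
Proof. by case=> g Hg <-; exists g; rewrite // -scalemxAr. Qed.

Lemma orbitN v w : lat_orbit H v w -> lat_orbit H (- v) (- w).
Proof. by rewrite -!scaleN1r; apply: orbitZ. Qed.

Lemma orbit_step g v w : H g -> lat_orbit H (g *m v) w -> lat_orbit H v w.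
Proof. by move=> Hg; apply: orbit_trans; exists g. Qed.

Lemma orbit_eq v w : lat_orbit H v w -> lat_orbit H v = lat_orbit H w.
Proof.
move=> vw; apply/seteqP; split=> x; apply: orbit_trans => //.
exact: orbit_sym.
Qed.

End Orbits.
End MatrixGroups.

(** * Primitive null vectors up to short reflections *)

Section ReflectionGroup.
Variable n : nat.
Local Notation R0 := (Reflec0 (lat_L n)).
Local Notation rho := (rho n).
Implicit Types (l : 'cV[E]_n) (a b c mu nu : E) (v w : 'cV[E]_(n + (1 + 1))).

Lemma short_refl_Aut xi (r : 'cV[E]_(n + (1 + 1))) :
  xi \is a GRing.unit -> <[r | r]> = 1 ->
  Aut_lat (lat_L n) (refl (lat_L n) (1 - xi) r).
Proof.
move=> u rr; apply: refl_Aut; [exact: lat_L_herm|exact: lat_L_unimod|].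
rewrite rr rmorphB rmorph1 mulr1 /=; have := eis_unit_conj u.
move=> h; ring: h.
Qed.

Lemma Reflec0_Aut : R0 `<=` Aut_lat (lat_L n).
Proof.
apply: generated_Aut => g /short_reflectionE[xi [r [_ u rr ->]]].
exact: short_refl_Aut.
Qed.

Lemma Reflec0_mxgroup : mxgroup R0.
Proof.
apply: generated_mxgroup => g /short_reflectionE[xi [r [_ u rr ->]]].
by case: (short_refl_Aut u rr).
Qed.

Lemma primitive_unitmx g v : g \in unitmx -> primitive v -> primitive (g *m v).
Proof.
move=> ug [v0 pv]; split=> [|w a gv].
  by apply: contra_neq v0 => gv0; rewrite -(mulKmx ug v) gv0 mulmx0.
by apply: (pv (invmx g *m w)); rewrite scalemxAr -gv mulKmx.
Qed.

Lemma primitive_null_Aut g v : Aut_lat (lat_L n) g ->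
  primitive_null (lat_L n) v -> primitive_null (lat_L n) (g *m v).
Proof.
move=> [ug gG] [pv v0]; split; first exact: primitive_unitmx.
by rewrite gG.
Qed.

Lemma rhoE : rho = vec_L 0 0 1. Proof. by []. Qed.

Definition corho : 'cV[E]_(n + (1 + 1)) := vec_L 0 1 0.

(** Descent on the height. A null vector of height 0 has lambda-part of norm
    0, hence is a multiple of rho. *)
Lemma orbit_unit_rho v : (n <= 3)%N -> primitive_null (lat_L n) v ->
  exists2 u, u \is a GRing.unit & lat_orbit R0 v (u *: rho).
Proof.
move=> n3; have [lam [mu [nu ->]]] := vec_LP v.
move: {2}`|eis_norm mu|%N (leqnn `|eis_norm mu|%N) => k.
elim: k lam mu nu => [|k IH] lam mu nu le pnv.
  have mu0 : mu = 0.
    by apply/eqP; rewrite -eis_norm_eq0 -absz_eq0; lia.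
  move: pnv; rewrite mu0 => -[[_ prim]].
  rewrite herm_vec_L rmorph0 mul0r mulr0 !addr0 hdot_norm.
  move=> /(@eis_intr_inj _ 0)/sum_norm_eq0 l0.
  exists nu; last first.
    rewrite rhoE vec_LZ l0 scaler0 mulr0 mulr1.
    exact: orbit_refl Reflec0_mxgroup _.
  by apply: (prim rho); rewrite rhoE vec_LZ l0 scaler0 mulr0 mulr1.
have [mu0|mu0] := eqVneq mu 0; first by apply: IH => //; rewrite mu0.
have vv : <[vec_L lam mu nu | vec_L lam mu nu]> = 0 by case: pnv.
have [xi [r [u rr [lam' [mu' [nu' [gE lt]]]]]]] := descent_step n3 mu0 vv.
have pn' : primitive_null (lat_L n) (vec_L lam' mu' nu').
  by rewrite -gE; apply: primitive_null_Aut => //; apply: short_refl_Aut.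
have le' : (`|eis_norm mu'| <= k)%N.
  by have := eis_norm_ge0 mu; have := eis_norm_ge0 mu'; lia.
have [u' uu orb] := IH _ _ _ le' pn'.
exists u' => //; apply: (orbit_step Reflec0_mxgroup (refl_Reflec0 u rr)).
by rewrite gE.
Qed.

Lemma unit_cases u : u \is a GRing.unit ->
  exists2 k, (k < 3)%N & u = omega ^+ k \/ u = - omega ^+ k.
Proof.
case: u => a b /eqP; rewrite /eis_norm /= => N1.
have bound (x y : int) : x ^+ 2 - x * y + y ^+ 2 = 1 -> -1 <= x <= 1.
  move=> e; have [z z0 x2] : exists2 z : int, 0 <= z & 3 * x ^+ 2 + z = 4.
    exists ((2 * y - x) ^+ 2); first exact: sqr_ge0.
    by transitivity (4 * (x ^+ 2 - x * y + y ^+ 2)); [ring|rewrite e].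
  by apply/andP; split; nia.
have /andP[a1 a2] := bound _ _ N1.
have /andP[b1 b2] : -1 <= b <= 1 by apply: (bound b a); rewrite -N1; ring.
have [a0|[a0|a0]] : a = -1 \/ a = 0 \/ a = 1 by lia.
- have [b0|b0] : b = -1 \/ b = 0 by rewrite a0 in N1; nia.
    by exists 2%N => //; left; rewrite a0 b0.
  by exists 0%N => //; right; rewrite a0 b0.
- have [b0|b0] : b = -1 \/ b = 1 by rewrite a0 in N1; nia.
    by exists 1%N => //; right; rewrite a0 b0.
  by exists 1%N => //; left; rewrite a0 b0.
have [b0|b0] : b = 0 \/ b = 1 by rewrite a0 in N1; nia.
  by exists 0%N => //; left; rewrite a0 b0.
by exists 2%N => //; right; rewrite a0 b0.
Qed.

Lemma orbit_short_refl H xi l mu nu l' mu' nu' l1 mu1 nu1 d :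
  H (refl (lat_L n) (1 - xi) (vec_L l mu nu)) ->
  d = (1 - xi) * (hdot l l' + eis_conj mu * nu' + eis_conj nu * mu') ->
  l' - d *: l = l1 -> mu' - d * mu = mu1 -> nu' - d * nu = nu1 ->
  lat_orbit H (vec_L l' mu' nu') (vec_L l1 mu1 nu1).
Proof. by move=> Hr -> <- <- <-; eexists; [exact: Hr|rewrite reflLE]. Qed.

(** The two short roots (0; 1, - omega) and (0; 1, - omega ^ 2) of II_{1,1}
    give rho -> conj omega * corho -> omega * rho. *)
Lemma orbit_omega_rho : lat_orbit R0 rho (omega *: rho).
Proof.
have root (nu : E) : nu + eis_conj nu = 1 ->
    R0 (refl (lat_L n) (1 - - omega) (vec_L 0 1 nu)).
  move=> nuE; apply: refl_Reflec0 => //.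
  by rewrite herm_vec_L hdot0l rmorph1 mul1r mulr1 add0r.
have step (nu mu' nu' mu1 nu1 : E) : nu + eis_conj nu = 1 ->
    let d := (1 - - omega) * (nu' + eis_conj nu * mu') in
    mu' - d = mu1 -> nu' - d * nu = nu1 ->
    lat_orbit R0 (vec_L 0 mu' nu') (vec_L 0 mu1 nu1).
  move=> /root Hr d mu1E nu1E; apply: (orbit_short_refl Hr erefl).
  - by rewrite scaler0 subr0.
  - by rewrite hdot0l rmorph1 mul1r mulr1 add0r.
  - by rewrite hdot0l rmorph1 mul1r add0r.
rewrite rhoE vec_LZ scaler0 mulr0 mulr1.
apply: (orbit_trans Reflec0_mxgroup (v2 := vec_L 0 (eis_conj omega) 0)).
  by apply: (step (- omega)).
by apply: (step (1 + omega)).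
Qed.

Lemma orbit_rho v : (n <= 3)%N -> primitive_null (lat_L n) v ->
  lat_orbit R0 v rho \/ lat_orbit R0 v (- rho).
Proof.
move=> n3 /(orbit_unit_rho n3)[u /unit_cases[k _ uk] vu].
have rk : lat_orbit R0 (omega ^+ k *: rho) rho.
  apply: (orbit_sym Reflec0_mxgroup).
  elim: k {uk} => [|k IH]; 
    first by rewrite expr0 scale1r; apply: orbit_refl Reflec0_mxgroup _.
  apply: (orbit_trans Reflec0_mxgroup orbit_omega_rho).
  by rewrite exprS -scalerA; apply: orbitZ.
case: uk => uE; rewrite uE in vu; [left|right].
  exact: (orbit_trans Reflec0_mxgroup vu).
by apply: (orbit_trans Reflec0_mxgroup vu); rewrite scaleNr; apply: orbitN.
Qed.

End ReflectionGroup.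

(** * The stabilizer of rho *)

Section Stabilizers.
Variable n : nat.
Local Notation R0 := (Reflec0 (lat_L n)).
Local Notation rho := (rho n).
Local Notation corho := (corho n).
Local Notation Frho := (fixator R0 rho).
Implicit Types (l : 'cV[E]_n) (a b c mu nu : E) (v w : 'cV[E]_(n + (1 + 1))).

Lemma Frho_mxgroup : mxgroup Frho.
Proof. exact/fixator_mxgroup/Reflec0_mxgroup. Qed.

Lemma hdot_unitv i : hdot (unitv i) (unitv i : 'cV[E]_n) = 1.
Proof. by rewrite hdot_unitvl mxE !eqxx. Qed.

Lemma heisenberg_refl xi i m : xi \is a GRing.unit ->
  Frho (refl (lat_L n) (1 - xi) (vec_L (unitv i) 0 m)).
Proof.
move=> u; split.
  apply: refl_Reflec0; rewrite // herm_vec_L hdot_unitv.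
  by rewrite rmorph0 mul0r mulr0 !addr0.
rewrite rhoE reflE herm_vec_L hdot0r rmorph0 mul0r mulr0 !addr0 mulr0 scale0r.
by rewrite subr0.
Qed.

(** One reflection in a short root (e_i; 0, m) suffices, since 1 - xi is a
    unit for xi of order 6. *)
Lemma kill_coord i l nu : exists nu',
  lat_orbit Frho (vec_L l 1 nu) (vec_L (l - l i 0 *: unitv i) 1 nu').
Proof.
(* Chosen so that (1 - xi) (l_i + conj m) = l_i for xi = - omega. *)
pose m := eis_conj (- omega * l i 0 - l i 0).
exists (nu - l i 0 * m).
have u : - omega \is a GRing.unit by [].
apply: (orbit_short_refl (heisenberg_refl i m u) (d := l i 0)) => //.
  rewrite hdot_unitvl rmorph0 mul0r mulr1 addr0 eis_conjK.
  by ring: omega_sqr.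
by rewrite mulr0 subr0.
Qed.

Lemma kill_coords l nu :
  exists nu', lat_orbit Frho (vec_L l 1 nu) (vec_L 0 1 nu').
Proof.
suff kill k : (k <= n)%N -> exists l' nu',
    lat_orbit Frho (vec_L l 1 nu) (vec_L l' 1 nu') /\
    forall i : 'I_n, (i < k)%N -> l' i 0 = 0.
  have [l' [nu' [orb l0]]] := kill n (leqnn n); exists nu'.
  suff <- : l' = 0 by [].
  by apply/matrixP => i j; rewrite ord1 mxE l0.
elim: k => [|k IH] kn.
  by exists l, nu; split=> //; apply: orbit_refl Frho_mxgroup _.
have [l' [nu' [orb l0]]] := IH (ltnW kn).
pose i0 := Ordinal kn; have [nu1 orb1] := kill_coord i0 l' nu'.
exists (l' - l' i0 0 *: unitv i0), nu1; split.
  exact: (orbit_trans Frho_mxgroup orb).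
move=> i; rewrite ltnS leq_eqVlt => /orP[/eqP ik|ik].
  have -> : i = i0 by apply: val_inj.
  by rewrite !mxE !eqxx mulr1 subrr.
have /negbTE ii0 : i != i0 by apply: contraTneq ik => ->; rewrite ltnn.
by rewrite !mxE (l0 i ik) ii0 mulr0 subr0.
Qed.

(** A reflection moves the vector out along e_i, a second one with another
    root brings it back; the composite is a generator of the centre of the
    Heisenberg group of translations. *)
Lemma central_shift nu : (0 < n)%N ->
  lat_orbit Frho (vec_L 0 1 nu) (vec_L 0 1 (nu - (1 + 2 * omega))).
Proof.
move=> n0; pose i := Ordinal n0; have u : - omega \is a GRing.unit by [].
apply: (orbit_trans Frho_mxgroup
  (v2 := vec_L (- (1 + omega) *: unitv i) 1 (nu - (1 + omega)))).
  apply: (orbit_short_refl (heisenberg_refl i 1 u) (d := 1 + omega)).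
  - by rewrite hdot0r !rmorph1 rmorph0 mul0r mulr1 !add0r mulr1 opprK.
  - by rewrite sub0r scaleNr.
  - by rewrite mulr0 subr0.
  - by rewrite mulr1.
apply: (orbit_short_refl (heisenberg_refl i (eis_conj omega) u)
  (d := - (1 + omega))).
- by rewrite hdotZr hdot_unitv eis_conjK rmorph0 mul0r.
- by rewrite subrr.
- by rewrite mulr0 subr0.
by rewrite conj_omega; ring: omega_sqr.
Qed.

(** After the coordinates in Lambda are removed, nu has real part 0, hence is
    an integral multiple of theta = 1 + 2 omega. *)
Lemma orbit_height1 w : (0 < n)%N -> <[w | w]> = 0 -> <[rho | w]> = 1 ->
  lat_orbit Frho w corho.
Proof.
move=> n0; have [l [mu [nu ->]]] := vec_LP w; rewrite {2}rhoE.
rewrite [X in _ -> X = _ -> _]herm_vec_L hdot0l rmorph0 mul0r rmorph1 mul1r.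
rewrite !add0r => + mu1; rewrite {}mu1 => w0.
have [nu' orb] := kill_coords l nu.
apply: (orbit_trans Frho_mxgroup orb).
have : <[vec_L 0 1 nu' | vec_L (0 : 'cV[E]_n) 1 nu']> = 0.
  case: orb => g [/Reflec0_Aut[_ gG] _] gE; rewrite -gE gG //.
rewrite herm_vec_L hdot0l add0r rmorph1 mul1r mulr1 eis_traceE.
move=> /(@eis_intr_inj _ 0).
have shift (j : nat) nu1 : lat_orbit Frho (vec_L 0 1 nu1)
    (vec_L 0 1 (nu1 - j%:R * (1 + 2 * omega))).
  elim: j nu1 => [|j IH] nu1.
    by rewrite mul0r subr0; apply: orbit_refl Frho_mxgroup _.
  apply: (orbit_trans Frho_mxgroup (IH nu1)).
  have -> : nu1 - j.+1%:R * (1 + 2 * omega) =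
      nu1 - j%:R * (1 + 2 * omega) - (1 + 2 * omega).
    by rewrite -natr1; ring.
  exact: central_shift.
case: nu' {orb} => a b; rewrite /eis_trace /= => b2a.
have -> : Eis a b = a%:~R * (1 + 2 * omega).
  by rewrite eis_intr; congr Eis; rewrite /=; lia.
case: a {b2a} => j.
  by have := shift j (j%:Z%:~R * (1 + 2 * omega)); rewrite pmulrn subrr.
apply: (orbit_sym Frho_mxgroup).
have := shift j.+1 0; rewrite sub0r -mulNr NegzE.
by rewrite rmorphN /= pmulrn.
Qed.

End Stabilizers.

(** * Transpositions of coordinates *)

Section Permutations.
Variable n : nat.
Local Notation R0 := (Reflec0 (lat_L n)).
Local Notation rho := (rho n).
Local Notation corho := (corho n).
Implicit Types (l : 'cV[E]_n) (a b c mu nu : E) (v w : 'cV[E]_(n + (1 + 1)))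
  (g h : 'M[E]_(n + (1 + 1))).

Definition basis_vec i : 'cV[E]_(n + (1 + 1)) := vec_L (unitv i) 0 0.

Lemma vec_L_basis l mu nu :
  vec_L l mu nu = \sum_i l i 0 *: basis_vec i + mu *: corho + nu *: rho.
Proof.
have -> : \sum_i l i 0 *: basis_vec i = vec_L l 0 0.
  rewrite {2}[l](_ : l = \sum_i l i 0 *: unitv i); last first.
    by rewrite {1}[l]matrix_sum_delta; apply: eq_bigr => i _; rewrite big_ord1.
  rewrite (big_morph (fun l => vec_L l 0 0) (id1 := 0) (op1 := +%R)).
  - by apply: eq_bigr => i _; rewrite /basis_vec vec_LZ !mulr0.
  - by move=> l1 l2; rewrite vec_LD !addr0.
  by rewrite /vec_L !raddf0 !col_mx0.
by rewrite rhoE !vec_LZ !vec_LD !scaler0 !addr0 !mulr0 !mulr1 !addr0 !add0r.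
Qed.

Lemma eq_on_basis g h : (forall i, g *m basis_vec i = h *m basis_vec i) ->
  g *m corho = h *m corho -> g *m rho = h *m rho -> g = h.
Proof.
move=> ghb ghe ghr; apply: eq_mulmx => v; have [l [mu [nu ->]]] := vec_LP v.
rewrite vec_L_basis !mulmxDr -!scalemxAr ghe ghr; congr (_ + _ + _).
by rewrite !mulmx_sumr; apply: eq_bigr => i _; rewrite -!scalemxAr ghb.
Qed.

Definition swap i j := refl (lat_L n) 1 (vec_L (unitv i - unitv j) 0 0).

Lemma swapE i j l mu nu : swap i j *m vec_L l mu nu =
  vec_L (l - (l i 0 - l j 0) *: (unitv i - unitv j)) mu nu.
Proof.
rewrite /swap reflLE; cbv zeta; rewrite rmorph0 !mul0r !mulr0 !subr0 mul1r.
by rewrite hdotDl -(scaleN1r (unitv j)) hdotZl rmorphN1 mulN1r !hdot_unitvl.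
Qed.

Lemma swap_rho i j : swap i j *m rho = rho.
Proof. by rewrite rhoE swapE !mxE subrr scale0r subr0. Qed.

Lemma swap_corho i j : swap i j *m corho = corho.
Proof. by rewrite swapE !mxE subrr scale0r subr0. Qed.

Lemma swap_basis_vec i j : i != j -> swap i j *m basis_vec j = basis_vec i.
Proof.
move=> /negbTE ij; rewrite /basis_vec swapE !mxE !eqxx ij /= sub0r.
by rewrite scaleN1r opprK addrC subrK.
Qed.

Lemma swap_basis_vec_id i j k :
  k != i -> k != j -> swap i j *m basis_vec k = basis_vec k.
Proof.
move=> ki kj; rewrite /basis_vec swapE !mxE ![_ == k]eq_sym.
by rewrite (negbTE ki) (negbTE kj) /= subrr scale0r subr0.
Qed.

Lemma negate_first k : (k <= n)%N -> exists2 g, R0 g & forall l mu nu,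
  g *m vec_L l mu nu =
  vec_L (\col_i (if (i < k)%N then - l i 0 else l i 0)) mu nu.
Proof.
elim: k => [|k IH] kn.
  exists 1%:M; first exact: gen_1.
  move=> l mu nu; rewrite mul1mx; congr vec_L; apply/matrixP => i j.
  by rewrite ord1 mxE.
have [g Rg gE] := IH (ltnW kn); pose k0 := Ordinal kn.
have [Rk _] := heisenberg_refl k0 0 (xi := -1) isT.
exists (refl (lat_L n) (1 - -1) (vec_L (unitv k0) 0 0) *m g).
  exact: gen_mul.
move=> l mu nu; rewrite -mulmxA gE reflLE; cbv zeta.
rewrite rmorph0 !mul0r !addr0 !mulr0 !subr0; congr vec_L.
apply/matrixP => i j; rewrite ord1 hdot_unitvl !mxE eqxx andbT /= ltnn ltnS.
have k0N : (i != k :> nat) -> (i == k0) = false by move/negbTE.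
case: (ltngtP i k) => [ik|ki|ik].
- by rewrite k0N ?mulr0 ?subr0 // (ltn_eqF ik).
- by rewrite k0N ?mulr0 ?subr0 // (gtn_eqF ki).
have -> : i = k0 by apply: val_inj.
by rewrite eqxx mulr1; ring.
Qed.

Lemma negate_Lambda : exists2 g, R0 g & forall l mu nu,
  g *m vec_L l mu nu = vec_L (- l) mu nu.
Proof.
have [g Rg gE] := negate_first (leqnn n); exists g => // l mu nu; rewrite gE.
by congr vec_L; apply/matrixP => i j; rewrite ord1 !mxE ltn_ord.
Qed.

Section Swap.
Variables (i j : 'I_n).
Hypothesis ij : i != j.

(** Coordinates on the sublattice E e_i + E e_j + II_{1,1}, on which a
    product of reflections with explicit roots can be evaluated by
    computation. *)
Definition plane (q : E * E * E * E) : 'cV[E]_(n + (1 + 1)) :=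
  let: (x, y, mu, nu) := q in vec_L (x *: unitv i + y *: unitv j) mu nu.

Definition plane_form (r q : E * E * E * E) : E :=
  let: (a, b, m, k) := r in let: (x, y, mu, nu) := q in
  eis_conj a * x + eis_conj b * y + eis_conj m * nu + eis_conj k * mu.

Definition plane_refl xi (r q : E * E * E * E) : E * E * E * E :=
  let d := (1 - xi) * plane_form r q in
  let: (a, b, m, k) := r in let: (x, y, mu, nu) := q in
  (x - d * a, y - d * b, mu - d * m, nu - d * k).

Lemma plane_herm r q : <[plane r | plane q]> = plane_form r q.
Proof.
case: r => [[[a b] m] k]; case: q => [[[x y] mu] nu].
rewrite herm_vec_L /plane_form hdotDl !hdotZl !hdot_unitvl !mxE !eqxx.
rewrite (negbTE ij) eq_sym (negbTE ij) /=.
by rewrite !mulr1 !mulr0 addr0 add0r.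
Qed.

Lemma plane_reflE xi r q :
  refl (lat_L n) (1 - xi) (plane r) *m plane q = plane (plane_refl xi r q).
Proof.
rewrite reflE plane_herm /plane_refl; set d := (1 - xi) * _.
case: r => [[[a b] m] k] in d *; case: q => [[[x y] mu] nu] in d *.
rewrite /= vec_LZ vec_LB; congr vec_L.
by rewrite scalerDr !scalerA !scalerBl opprD addrACA.
Qed.

Lemma plane_refl_perp c r l : l i 0 = 0 -> l j 0 = 0 ->
  refl (lat_L n) c (plane r) *m vec_L l 0 0 = vec_L l 0 0.
Proof.
case: r => [[[a b] m] k] li lj; rewrite reflE herm_vec_L.
rewrite hdotDl !hdotZl !hdot_unitvl li lj !mulr0 ?addr0 ?mulr0 scale0r.
by rewrite subr0.
Qed.

Definition plane_word (s : seq (E * (E * E * E * E))) : 'M[E]_(n + (1 + 1)) :=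
  foldr (fun p g => refl (lat_L n) (1 - p.1) (plane p.2) *m g) 1%:M s.

Lemma plane_word_Reflec0 s :
  all (fun p => (p.1 \is a GRing.unit) && (plane_form p.2 p.2 == 1)) s ->
  R0 (plane_word s).
Proof.
elim: s => [_|[xi r] s IH /= /andP[/andP[u /eqP rr] /IH]]; first exact: gen_1.
by apply: gen_mul; apply: refl_Reflec0; rewrite // plane_herm.
Qed.

Lemma plane_wordE s q : plane_word s *m plane q =
  plane (foldr (fun p => plane_refl p.1 p.2) q s).
Proof.
elim: s => [|[xi r] s IH] /=; first by rewrite mul1mx.
by rewrite -mulmxA IH plane_reflE.
Qed.

Lemma plane_word_perp s k :
  k != i -> k != j -> plane_word s *m basis_vec k = basis_vec k.
Proof.
move=> ki kj; elim: s => [|[xi r] s IH] /=; first by rewrite mul1mx.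
rewrite -mulmxA IH plane_refl_perp // !mxE.
  by rewrite eq_sym (negbTE ki).
by rewrite eq_sym (negbTE kj).
Qed.

(** The five reflections consist of three that lead from rho to - rho,
    followed by two that fix rho and send the image of corho to - corho. *)
Lemma swap_word : exists2 g, R0 g &
  [/\ g *m rho = - rho, g *m corho = - corho,
      g *m basis_vec i = - basis_vec j, g *m basis_vec j = basis_vec i
    & forall k, k != i -> k != j -> g *m basis_vec k = basis_vec k].
Proof.
pose w2 := omega ^+ 2.
(* The last entry acts first. *)
pose word : seq (E * (E * E * E * E)) :=
  [:: (- omega, (1, 0, 0, 1 - omega)); (w2, (1, 0, 0, - w2));
      (- omega, (0, 0, 1, - w2)); (- omega, (1, 1, - omega, -1));
      (- omega, (1, 1, 1, w2))].
have wordE (q q' : E * E * E * E) :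
    foldr (fun p => plane_refl p.1 p.2) q word = q' ->
    plane_word word *m plane q = plane q'.
  by move=> <-; apply: plane_wordE.
exists (plane_word word); first by apply: plane_word_Reflec0.
have rhoP x : x *: rho = plane (0, 0, 0, x).
  by rewrite /= rhoE vec_LZ !scale0r scaler0 addr0 mulr0 mulr1.
have evP x : x *: corho = plane (0, 0, x, 0).
  by rewrite /= vec_LZ !scale0r scaler0 addr0 mulr0 mulr1.
have biP x : x *: basis_vec i = plane (x, 0, 0, 0).
  by rewrite /= vec_LZ scale0r addr0 mulr0.
have bjP x : x *: basis_vec j = plane (0, x, 0, 0).
  by rewrite /= vec_LZ scale0r add0r mulr0.
split.
- by rewrite -scaleN1r -{1}[rho]scale1r !rhoP; apply: wordE.
- by rewrite -scaleN1r -{1}[corho]scale1r !evP; apply: wordE.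
- by rewrite -scaleN1r -{1}[basis_vec i]scale1r biP bjP; apply: wordE.
- by rewrite -[basis_vec j]scale1r -[basis_vec i]scale1r biP bjP; apply: wordE.
by move=> k; apply: plane_word_perp.
Qed.

End Swap.
End Permutations.

(** * The automorphism group of L *)

Section Automorphisms.
Variable n : nat.
Local Notation R0 := (Reflec0 (lat_L n)).
Local Notation rho := (rho n).
Local Notation corho := (corho n).
Implicit Types (l : 'cV[E]_n) (a b c mu nu : E) (v w : 'cV[E]_(n + (1 + 1)))
  (g h : 'M[E]_(n + (1 + 1))).

Lemma swapC i j : swap i j = swap j i :> 'M[E]_(n + (1 + 1)).
Proof.
rewrite /swap -reflN; congr refl.
by rewrite vec_LN opprB oppr0.
Qed.

Lemma scale_basis_vec u i : u \is a GRing.unit -> exists2 g, R0 g &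
  [/\ g *m rho = rho, g *m corho = corho, g *m basis_vec i = u *: basis_vec i
    & forall k, k != i -> g *m basis_vec k = basis_vec k].
Proof.
move=> uu; exists (refl (lat_L n) (1 - u) (basis_vec i)).
  by case: (heisenberg_refl i 0 uu).
split=> [|||k /negbTE ki]; rewrite reflE herm_vec_L.
- by rewrite hdot0r rmorph0 !mul0r !addr0 mulr0 scale0r subr0.
- by rewrite hdot0r rmorph0 !mul0r !addr0 mulr0 scale0r subr0.
- by rewrite hdot_unitv rmorph0 !mul0r !addr0 mulr1 scalerBl scale1r subKr.
- rewrite hdot_unitvl mxE eq_sym ki rmorph0.
  by rewrite !mul0r !addr0 mulr0 scale0r subr0.
Qed.

(** The word of [swap_word] agrees with minus the transposition up to signs
    of basis vectors of Lambda, and sign changes are short reflections. *)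
Lemma neg_swap_Reflec0 i j : i != j -> R0 (- swap i j).
Proof.
move=> ij; have [W RW [Wr We Wi Wj Wk]] := swap_word ij.
have [D RD DE] := negate_Lambda n.
have [S RS [Sr Se Sj Sk]] := @scale_basis_vec (-1) j isT.
have Db k : D *m basis_vec k = - basis_vec k by rewrite DE vec_LN oppr0.
have De : D *m corho = corho by rewrite DE oppr0.
have Dr : D *m rho = rho by rewrite rhoE DE oppr0.
have -> : - swap i j = S *m (D *m W).
  apply: eq_on_basis => [k||]; rewrite mulNmx -!mulmxA.
  - have [->|ki] := eqVneq k i.
      rewrite Wi mulmxN Db opprK Sj swapC scaleN1r.
      by rewrite swap_basis_vec 1?eq_sym.
    have [->|kj] := eqVneq k j.
      by rewrite Wj Db mulmxN Sk // swap_basis_vec.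
    by rewrite Wk // Db mulmxN Sk // swap_basis_vec_id.
  - by rewrite We mulmxN De mulmxN Se swap_corho.
  - by rewrite Wr mulmxN Dr mulmxN Sr swap_rho.
exact: gen_mul RS (gen_mul RD RW).
Qed.

Definition Reflec0_pm : set 'M[E]_(n + (1 + 1)) := [set g | R0 g \/ R0 (- g)].

Lemma Reflec0_pm_mxgroup : mxgroup Reflec0_pm.
Proof.
have [R1 RM RV] := Reflec0_mxgroup n.
split=> [|g h|g]; first by left.
- case=> Rg [] Rh; [left|right|right|left].
  + exact: RM.
  + by rewrite -mulmxN; apply: RM.
  + by rewrite -mulNmx; apply: RM.
  + by rewrite -[g *m h]opprK -mulmxN -mulNmx; apply: RM.
have invN (A : 'M[E]_(n + (1 + 1))) : A \in unitmx -> invmx (- A) = - invmx A.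
  by move=> uA; rewrite -!scaleN1r invmxZ ?unitmxZ ?unitrN1 // invrN1.
case=> /RV[ug Rg]; first by split=> //; left.
have ug' : g \in unitmx by rewrite -[g]opprK -scaleN1r unitmxZ ?unitrN1.
by split=> //; right; rewrite -invN.
Qed.

Lemma sum_norm_eq1 l : \sum_i eis_norm (l i 0) = 1 ->
  exists j, exists2 u, u \is a GRing.unit & l = u *: unitv j.
Proof.
have key (x y : int) : 0 < x -> 0 <= y -> x + y = 1 -> x = 1 /\ y = 0 by lia.
move=> s1; have [j lj] : exists j, l j 0 != 0.
  apply: contrapT => /forallNP l0; move: s1; rewrite big1 // => i _.
  by have /negP := l0 i; rewrite negbK => /eqP ->.
have rest0 : 0 <= \sum_(i | i != j) eis_norm (l i 0).
  by apply: sumr_ge0 => i _; apply: eis_norm_ge0.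
have lj0 := eis_norm_gt0 lj; move: s1; rewrite (bigD1 j) //= => s1.
have [lj1 rest_eq0] := key _ _ lj0 rest0 s1.
exists j, (l j 0); first exact/eqP.
apply/matrixP => i k; rewrite ord1 !mxE eqxx andbT.
have [->|ij] := eqVneq i j; first by rewrite mulr1.
rewrite mulr0; apply/eqP; rewrite -eis_norm_eq0.
move/eqP: rest_eq0.
rewrite psumr_eq0 => [/allP/(_ i)|k' _]; last exact: eis_norm_ge0.
by rewrite mem_index_enum ij; apply.
Qed.

(** An isometry fixing rho and corho acts on Lambda, whose vectors of norm 1
    are the unit multiples of the basis vectors. The basis vectors are fixed
    one after the other by a transposition and a short reflection. The group
    H is a parameter because this is used for Reflec0 together with - I, and,
    when there is nothing to transpose, for Reflec0 alone. *)
Lemma fix_hyperbolic_plane (H : set 'M[E]_(n + (1 + 1))) :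
  mxgroup H -> R0 `<=` H ->
  H `<=` Aut_lat (lat_L n) -> (forall i j, i != j -> H (swap i j)) ->
  forall g, Aut_lat (lat_L n) g -> g *m rho = rho -> g *m corho = corho -> H g.
Proof.
move=> groupH RH HA Hswap.
suff fix_first d : forall k, (k + d = n)%N ->
    forall g, Aut_lat (lat_L n) g -> g *m rho = rho -> g *m corho = corho ->
    (forall i : 'I_n, (i < k)%N -> g *m basis_vec i = basis_vec i) -> H g.
  by move=> g Ag gr ge; apply: (fix_first n 0%N).
case: (groupH) => H1 HM HV; elim: d => [|d IH] k.
  rewrite addn0 => kn g _ gr ge gb; suff -> : g = 1%:M by [].
  by apply: eq_on_basis => [i||]; rewrite mul1mx // gb // kn.
move=> kd g Ag gr ge gb; have kn : (k < n)%N by lia.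
pose k0 := Ordinal kn; case: (Ag) => [_ gG].
have [j [u uu gk]] : exists j, exists2 u, u \is a GRing.unit &
    g *m basis_vec k0 = u *: basis_vec j.
  have [l [mu [nu wE]]] := vec_LP (g *m basis_vec k0).
  have mu0 : mu = 0.
    have := gG rho (basis_vec k0); rewrite gr wE rhoE !herm_vec_L !hdot0l.
    by rewrite rmorph1 rmorph0 !mul0r !mul1r !add0r.
  have nu0 : nu = 0.
    have := gG corho (basis_vec k0); rewrite ge wE !herm_vec_L !hdot0l.
    by rewrite rmorph1 rmorph0 !mul0r !mul1r !add0r !addr0.
  have : hdot l l = 1.
    have := gG (basis_vec k0) (basis_vec k0).
    rewrite wE mu0 nu0 !herm_vec_L hdot_unitv rmorph0.
    by rewrite !mul0r !addr0.
  rewrite hdot_norm => /(@eis_intr_inj _ 1)/sum_norm_eq1[j [u uu lE]].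
  by exists j, u; rewrite // wE mu0 nu0 lE vec_LZ !mulr0.
have ltjk (i : 'I_n) : (i < k)%N -> i != j.
  move=> ik; apply: contraTneq (uu) => ij.
  have := gG (basis_vec i) (basis_vec k0).
  rewrite (gb i ik) gk ij vec_LZ !herm_vec_L hdotZr hdot_unitv.
  rewrite hdot_unitvl mxE rmorph0 !mul0r !mulr1 !addr0 -ij.
  have /negbTE -> : i != k0 by apply: contraTneq ik => ->; rewrite ltnn.
  by move=> ->.
have [t Ht [tr te tj tk]] : exists2 t, H t &
    [/\ t *m rho = rho, t *m corho = corho, t *m basis_vec j = basis_vec k0
      & forall i : 'I_n, (i < k)%N -> t *m basis_vec i = basis_vec i].
  have [->|jk] := eqVneq j k0.
    by exists 1%:M; rewrite ?mul1mx //; split=> // *; rewrite mul1mx.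
  exists (swap k0 j); first by apply: Hswap; rewrite eq_sym.
  split; [exact: swap_rho|exact: swap_corho| |].
    by apply: swap_basis_vec; rewrite eq_sym.
  move=> i ik; apply: swap_basis_vec_id; last exact: ltjk.
  by apply: contraTneq ik => ->; rewrite ltnn.
have uu' : eis_conj u \is a GRing.unit.
  by apply/eqP; rewrite eis_norm_conj; apply/eqP.
have [S RS [Sr Se Sk0 Sk]] := scale_basis_vec k0 uu'.
have HSt : H (S *m t) by apply: HM => //; apply: RH.
have [uSt HV_St] := HV _ HSt.
rewrite -(mulKmx uSt g); apply: HM => //.
have kd' : (k.+1 + d = n)%N by lia.
apply: (IH k.+1 kd').
- by apply: Aut_latM => //; apply: HA.
- by rewrite -!mulmxA gr tr.
- by rewrite -!mulmxA ge te.
move=> i; rewrite ltnS leq_eqVlt => /orP[/eqP ik|ik].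
  have -> : i = k0 by apply: val_inj.
  rewrite -!mulmxA gk -!scalemxAr tj Sk0 scalerA mulrC eis_unit_conj //.
  by rewrite scale1r.
rewrite -!mulmxA (gb i ik) tk // Sk //.
by apply: contraTneq ik => ->; rewrite ltnn.
Qed.

Lemma fix_null_vector (H : set 'M[E]_(n + (1 + 1))) : (0 < n)%N ->
  mxgroup H -> R0 `<=` H -> H `<=` Aut_lat (lat_L n) ->
  (forall i j, i != j -> H (swap i j)) ->
  forall g, Aut_lat (lat_L n) g -> g *m rho = rho -> H g.
Proof.
move=> n0 groupH RH HA Hswap g Ag gr; case: (Ag) => _ gG.
have [||h [Rh hr] hge] := @orbit_height1 n (g *m corho) n0.
- by rewrite gG herm_vec_L hdot0l rmorph0 mulr0 mul0r !addr0.
- by rewrite -gr gG rhoE herm_vec_L hdot0l rmorph0 rmorph1 mul0r mul1r !add0r.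
case: (groupH) => _ HM HV; have [uh HVh] := HV _ (RH _ Rh).
rewrite -(mulKmx uh g); apply: HM => //.
apply: (fix_hyperbolic_plane groupH RH HA Hswap).
- by apply: Aut_latM => //; apply: HA; apply: RH.
- by rewrite -mulmxA gr hr.
by rewrite -mulmxA.
Qed.

Lemma Reflec0_pm_Aut : Reflec0_pm `<=` Aut_lat (lat_L n).
Proof.
move=> g [/Reflec0_Aut//|/Reflec0_Aut/Aut_latN].
by rewrite opprK.
Qed.

Lemma rho_primitive_null : primitive_null (lat_L n) rho.
Proof.
split; last by rewrite rhoE herm_vec_L hdot0l rmorph0 mul0r mulr0 !addr0.
split=> [|w a].
  apply/eqP; rewrite rhoE => h.
  have : vec_L 0 0 1 = vec_L (0 : 'cV[E]_n) 0 0.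
    by rewrite h /vec_L !raddf0 !col_mx0.
  by case/vec_L_inj.
have [l [mu [nu ->]]] := vec_LP w.
rewrite rhoE vec_LZ => /vec_L_inj[_ _ /esym anu].
by apply/unitrPr; exists nu.
Qed.

Lemma Aut_latE : (0 < n)%N -> (n <= 3)%N -> Aut_lat (lat_L n) = Reflec0_pm.
Proof.
move=> n0 n3; apply/seteqP; split=> [g Ag|]; last exact: Reflec0_pm_Aut.
have fixR := fix_null_vector n0 Reflec0_pm_mxgroup
  (fun g Rg => or_introl Rg) Reflec0_pm_Aut
  (fun i j ij => or_intror (neg_swap_Reflec0 ij)).
have [_ RM RV] := Reflec0_pm_mxgroup.
suff [h Rh hgr] : exists2 h, Reflec0_pm h & h *m g *m rho = rho.
  have [uh RVh] := RV _ Rh; rewrite -(mulKmx uh g); apply: RM => //.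
  by apply: fixR => //; apply: Aut_latM => //; apply: Reflec0_pm_Aut.
have [[h Rh hgr]|[h Rh hgr]] :=
  orbit_rho n3 (primitive_null_Aut Ag rho_primitive_null).
  by exists h; [left|rewrite -mulmxA].
exists (- h); first by right; rewrite opprK.
by rewrite -mulmxA mulNmx hgr opprK.
Qed.

Lemma transitive_Reflec0 : (1 < n)%N -> (n <= 3)%N ->
  transitive_on R0 (primitive_null (lat_L n)).
Proof.
move=> n1 n3.
have to_rho v : primitive_null (lat_L n) v -> lat_orbit R0 v rho.
  move=> /(orbit_rho n3)[//|vr]; apply: (orbit_trans (Reflec0_mxgroup n) vr).
  pose i := Ordinal (ltnW n1); pose j := Ordinal n1.
  exists (- swap i j); first exact: neg_swap_Reflec0.
  by rewrite mulNmx mulmxN opprK swap_rho.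
move=> v w /to_rho vr /to_rho wr.
exact: (orbit_trans (Reflec0_mxgroup n) vr (orbit_sym (Reflec0_mxgroup n) wr)).
Qed.

End Automorphisms.

(** * A Clifford module over F_3 *)

Section Clifford.
Variables (A : comPzRingType) (al be : A).
Hypothesis quat : al ^+ 2 = - 1 - be ^+ 2.

Definition spinor : Type := (A * A * A * A)%type.
Definition qvector : Type := (A * A * A * A * A)%type.
Implicit Types (u v r : qvector) (psi phi : spinor) (a : A).

Definition spinD psi phi : spinor :=
  let: (p1, p2, q1, q2) := psi in let: (p1', p2', q1', q2') := phi in
  (p1 + p1', p2 + p2', q1 + q1', q2 + q2').

Definition spinZ a psi : spinor :=
  let: (p1, p2, q1, q2) := psi in (a * p1, a * p2, a * q1, a * q2).

(** The combination a u - v, which is the shape of minus a reflected vector. *)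
Definition qlin a u v : qvector :=
  let: (x1, x2, x3, y, z) := u in let: (x1', x2', x3', y', z') := v in
  (a * x1 - x1', a * x2 - x2', a * x3 - x3', a * y - y', a * z - z').

Definition qform u v : A :=
  let: (x1, x2, x3, y, z) := u in let: (x1', x2', x3', y', z') := v in
  x1 * x1' + x2 * x2' + x3 * x3' + y * z' + z * y'.

(** In blocks of size 2, the vector (x1, x2, x3, y, z) acts as [[X, - 2 y],
    [z, - X]] with X = x1 i + x2 j + x3 k, where i = [[0, 1], [-1, 0]], j =
    [[al, be], [be, - al]] and k = i j satisfy the quaternion relations by
    the hypothesis on al and be. *)
Definition cliff v psi : spinor :=
  let: (x1, x2, x3, y, z) := v in let: (p1, p2, q1, q2) := psi in
  let s := al * x2 + be * x3 in let t := be * x2 - al * x3 in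
  (s * p1 + (x1 + t) * p2 - 2 * y * q1, (t - x1) * p1 - s * p2 - 2 * y * q2,
   z * p1 - s * q1 - (x1 + t) * q2, z * p2 - (t - x1) * q1 + s * q2).

Definition symp psi phi : A :=
  let: (p1, p2, q1, q2) := psi in let: (p1', p2', q1', q2') := phi in
  p1 * q2' - p2 * q1' + q1 * p2' - q2 * p1'.

Lemma cliff_anticomm u v psi :
  spinD (cliff u (cliff v psi)) (cliff v (cliff u psi)) =
  spinZ (- 2 * qform u v) psi.
Proof.
move: u v psi => [[[[u1 u2] u3] u4] u5] [[[[v1 v2] v3] v4] v5] [[[p1 p2] q1] q2].
by congr (_, _, _, _); rewrite /qform; ring: quat.
Qed.

Lemma cliff_sqr v psi : cliff v (cliff v psi) = spinZ (- qform v v) psi.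
Proof.
move: v psi => [[[[v1 v2] v3] v4] v5] [[[p1 p2] q1] q2].
by congr (_, _, _, _); rewrite /qform; ring: quat.
Qed.

Lemma cliff_adjoint v psi phi : symp (cliff v psi) phi = symp psi (cliff v phi).
Proof.
move: v psi phi => [[[[v1 v2] v3] v4] v5] [[[p1 p2] q1] q2] [[[r1 r2] s1] s2].
by rewrite /symp /=; ring.
Qed.

Lemma cliff_lin a u v psi :
  cliff (qlin a u v) psi =
  spinD (spinZ a (cliff u psi)) (spinZ (-1) (cliff v psi)).
Proof.
move: u v psi => [[[[u1 u2] u3] u4] u5] [[[[v1 v2] v3] v4] v5] [[[p1 p2] q1] q2].
by congr (_, _, _, _); ring.
Qed.

Lemma cliffZ v a psi : cliff v (spinZ a psi) = spinZ a (cliff v psi).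
Proof.
move: v psi => [[[[v1 v2] v3] v4] v5] [[[p1 p2] q1] q2].
by congr (_, _, _, _); ring.
Qed.

Lemma spinZZ a b psi : spinZ a (spinZ b psi) = spinZ (a * b) psi.
Proof. by move: psi => [[[p1 p2] q1] q2]; rewrite /= !mulrA. Qed.

Lemma spinZ1 psi : spinZ 1 psi = psi.
Proof. by move: psi => [[[p1 p2] q1] q2]; rewrite /= !mul1r. Qed.

Lemma spin0D psi phi : spinD (spinZ 0 psi) phi = phi.
Proof.
by move: psi phi => [[[p1 p2] q1] q2] [[[r1 r2] s1] s2]; rewrite /= !mul0r !add0r.
Qed.

Lemma sympZr a psi phi : symp psi (spinZ a phi) = a * symp psi phi.
Proof.
by move: psi phi => [[[p1 p2] q1] q2] [[[r1 r2] s1] s2]; rewrite /symp /=; ring.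
Qed.

(** This is the Clifford relation solved for r v, with r r replaced by minus
    the norm of r. *)
Lemma cliff_reflection d r v psi : d * qform r r = 2 ->
  cliff r (cliff v psi) = cliff (qlin (d * qform r v) r v) (cliff r psi).
Proof.
move=> dr; rewrite cliff_lin cliff_sqr.
have := cliff_anticomm r v psi.
move: (cliff r (cliff v psi)) (cliff v (cliff r psi)).
move: psi => [[[p1 p2] q1] q2] [[[a1 a2] b1] b2] [[[c1 c2] d1] d2] [e1 e2 e3 e4].
have key a c p : a + c = - 2 * qform r v * p ->
    a = d * qform r v * (- qform r r * p) + - 1 * c.
  by move=> e; rewrite -[LHS](addrK c) e -dr; ring.
by congr (_, _, _, _); apply: key.
Qed.

End Clifford.

Local Notation F := 'F_3.

Lemma F3_three : 3 = 0 :> F. Proof. by apply/val_inj. Qed.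

Lemma F3_two : 2 = -1 :> F. Proof. by apply/val_inj. Qed.

(** Reduction modulo theta = 1 + 2 omega, which sends omega to 1. *)
Definition mod_theta (x : E) : F := (eisA x)%:~R + (eisB x)%:~R.

Lemma mod_theta_is_zmod_morphism : zmod_morphism mod_theta.
Proof.
by move=> [a b] [c d]; rewrite /mod_theta /= !rmorphD !rmorphN /=; ring.
Qed.

Lemma mod_theta_is_monoid_morphism : monoid_morphism mod_theta.
Proof.
split; first by rewrite /mod_theta /= addr0.
move=> [a b] [c d]; rewrite /mod_theta /= !(rmorphD, rmorphN, rmorphM) /=.
apply/eqP; rewrite -subr_eq0.
rewrite [X in X == _](_ : _ = - (3 * b%:~R * d%:~R)); last by ring.
by rewrite F3_three !mul0r oppr0.
Qed.

HB.instance Definition _ :=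
  GRing.isZmodMorphism.Build E F mod_theta mod_theta_is_zmod_morphism.
HB.instance Definition _ :=
  GRing.isMonoidMorphism.Build E F mod_theta mod_theta_is_monoid_morphism.

Lemma mod_theta_conj x : mod_theta (eis_conj x) = mod_theta x.
Proof.
case: x => a b; rewrite /mod_theta /= rmorphB rmorphN /=.
apply/eqP; rewrite -subr_eq0 [X in X == _](_ : _ = - (3 * b%:~R)); last by ring.
by rewrite F3_three mul0r oppr0.
Qed.

Lemma mod_theta_unit u :
  u \is a GRing.unit -> mod_theta u = 1 \/ mod_theta u = -1.
Proof.
move=> /unit_cases[k _ uk].
have redk : mod_theta (omega ^+ k) = 1.
  by rewrite rmorphXn /= /mod_theta /= add0r expr1n.
by case: uk => ->; [left|right; rewrite rmorphN /= redk].
Qed.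

Definition coords (v : 'cV[E]_(3 + (1 + 1))) : qvector F :=
  (mod_theta (usubmx v ord0 0), mod_theta (usubmx v (lift ord0 ord0) 0),
   mod_theta (usubmx v (lift ord0 (lift ord0 ord0)) 0),
   mod_theta (usubmx (dsubmx v) 0 0), mod_theta (dsubmx (dsubmx v) 0 0)).

Lemma coords_vec_L l mu nu : coords (vec_L l mu nu) =
  (mod_theta (l ord0 0), mod_theta (l (lift ord0 ord0) 0),
   mod_theta (l (lift ord0 (lift ord0 ord0)) 0), mod_theta mu, mod_theta nu).
Proof. by rewrite /coords /vec_L !col_mxKd !col_mxKu !mxE /= !mulr1n. Qed.

Lemma qform_coords u v : qform (coords u) (coords v) = mod_theta <[u | v]>.
Proof.
have [l [mu [nu ->]]] := vec_LP u; have [l' [mu' [nu' ->]]] := vec_LP v.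
rewrite herm_vec_L !coords_vec_L /hdot !big_ord_recl big_ord0 /qform.
by rewrite !(rmorphD, rmorphM) /= !mod_theta_conj rmorph0 addr0 !addrA.
Qed.

Lemma coords_lin a u v :
  coords (a *: u - v) = qlin (mod_theta a) (coords u) (coords v).
Proof.
have [l [mu [nu ->]]] := vec_LP u; have [l' [mu' [nu' ->]]] := vec_LP v.
by rewrite vec_LZ vec_LB !coords_vec_L !mxE /= !(rmorphB, rmorphM).
Qed.

HB.lock Definition gamma (v : 'cV[E]_(3 + (1 + 1))) : spinor F -> spinor F :=
  cliff 1 1 (coords v).

Lemma quat3 : (1 : F) ^+ 2 = - 1 - 1 ^+ 2. Proof. by apply/val_inj. Qed.

Lemma gamma_reflection d r v psi : mod_theta d * mod_theta <[r | r]> = 2 ->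
  gamma r (gamma v psi) = gamma (- (refl (lat_L 3) d r *m v)) (gamma r psi).
Proof.
move=> dr.
rewrite unlock (cliff_reflection quat3 (d := mod_theta d)) ?qform_coords //.
by congr cliff; rewrite reflE opprB coords_lin rmorphM.
Qed.

Lemma gamma_sqr v psi :
  gamma v (gamma v psi) = spinZ (- mod_theta <[v | v]>) psi.
Proof. by rewrite unlock (cliff_sqr quat3) qform_coords. Qed.

Lemma gamma_adjoint v psi phi : symp (gamma v psi) phi = symp psi (gamma v phi).
Proof. by rewrite unlock cliff_adjoint. Qed.

Lemma gammaZ v a psi : gamma v (spinZ a psi) = spinZ a (gamma v psi).
Proof. by rewrite unlock cliffZ. Qed.

Lemma gamma_lin a u v psi : gamma (a *: u - v) psi =
  spinD (spinZ (mod_theta a) (gamma u psi)) (spinZ (-1) (gamma v psi)).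
Proof. by rewrite unlock coords_lin cliff_lin. Qed.

(** * The spinor norm *)

Section SpinLifts.
Implicit Types (g h : 'M[E]_(3 + (1 + 1))) (P Q : spinor F -> spinor F)
  (s t : bool).

(** The operators P and Q are inverse lifts of g to spinors; s and t record
    the signs by which P transforms the Clifford action and the symplectic
    form. *)
Definition intertwines g P Q s t :=
  [/\ cancel P Q, cancel Q P,
      forall v psi, P (gamma v psi) = gamma ((-1) ^+ s *: (g *m v)) (P psi)
    & forall psi phi, symp (P psi) (P phi) = (-1) ^+ t * symp psi phi].

Lemma intertwines1 : intertwines 1%:M id id false false.
Proof. by split=> // [v psi|psi phi]; rewrite ?mul1mx ?scale1r ?mul1r. Qed.

Lemma intertwinesM g P Q s t g' P' Q' s' t' :
  intertwines g P Q s t -> intertwines g' P' Q' s' t' ->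
  intertwines (g *m g') (P \o P') (Q' \o Q) (s (+) s') (t (+) t').
Proof.
move=> [PQ QP Pg Pt] [PQ' QP' Pg' Pt']; split=> [||v psi|psi phi].
- by move=> psi; rewrite /= PQ PQ'.
- by move=> psi; rewrite /= QP' QP.
- by rewrite /= Pg' Pg -scalemxAr scalerA signr_addb mulmxA.
by rewrite /= Pt Pt' mulrA signr_addb.
Qed.

Lemma intertwinesV g P Q s t : g \in unitmx -> intertwines g P Q s t ->
  intertwines (invmx g) Q P s t.
Proof.
move=> ug [PQ QP Pg Pt]; split=> // [v psi|psi phi].
  have := Pg ((-1) ^+ s *: (invmx g *m v)) (Q psi).
  rewrite -scalemxAr scalerA -signr_addb addbb scale1r mulKVmx // QP => <-.
  by rewrite PQ.
by rewrite -{2}(QP psi) -{2}(QP phi) Pt signrMK.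
Qed.

(** The two possible values of the spinor norm modulo theta. *)
Definition spin g := exists P Q s, intertwines g P Q s s.
Definition cospin g := exists P Q s, intertwines g P Q s (~~ s).

Lemma spinM g h : spin g -> spin h -> spin (g *m h).
Proof.
move=> [P [Q [s Pg]]] [P' [Q' [s' Pg']]].
by do 3!eexists; apply: intertwinesM Pg Pg'.
Qed.

Lemma gammaN v psi : gamma (- v) psi = spinZ (-1) (gamma v psi).
Proof. by rewrite -[- v]add0r -(scale0r v) gamma_lin rmorph0 spin0D. Qed.

Lemma gamma_sign s v psi :
  gamma ((-1) ^+ s *: v) psi = spinZ ((-1) ^+ s) (gamma v psi).
Proof. by case: s; rewrite ?scaleN1r ?gammaN // scale1r spinZ1. Qed.

(** A short reflection by xi is trivial modulo theta or is the reflection of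
    order 2 in r. In the second case gamma r is a lift; its square is - 1, so
    it changes the sign of the symplectic form, and it also changes the sign
    of the Clifford action. *)
Lemma spin_Reflec0 : Reflec0 (lat_L 3) `<=` spin.
Proof.
have [_ _ R0u] := Reflec0_mxgroup 3.
move=> g Rg; elim: (Rg) => [{Rg}g||h k _ sh _ sk|h Rh [P [Q [s Ph]]]].
- move=> /short_reflectionE[xi [r [_ u rr ->]]].
  have [xi1|xi1] := mod_theta_unit u.
    exists id, id, false; split=> // [v psi|psi phi]; last by rewrite mul1r.
    rewrite scale1r reflE -opprB gammaN gamma_lin rmorphM rmorphB /= xi1 rmorph1.
    by rewrite subrr mul0r spin0D spinZZ mulrNN mulr1 spinZ1.
  have gg phi : gamma r (gamma r phi) = spinZ (-1) phi.
    by rewrite gamma_sqr rr rmorph1.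
  exists (gamma r), (fun psi => spinZ (-1) (gamma r psi)), true.
  split=> [psi|psi|v psi|psi phi].
  + by rewrite gg spinZZ mulrNN mulr1 spinZ1.
  + by rewrite gammaZ gg spinZZ mulrNN mulr1 spinZ1.
  + rewrite scaleN1r; apply: gamma_reflection.
    by rewrite rr rmorphB /= xi1 !rmorph1 mulr1 opprK.
  by rewrite gamma_adjoint gg sympZr.
- by exists id, id, false; apply: intertwines1.
- exact: spinM.
by exists Q, P, s; apply: intertwinesV => //; case: (R0u _ Rh).
Qed.

Lemma cospin_opp1 : cospin (- 1%:M).
Proof.
exists id, id, true; split=> // [v psi|psi phi]; last by rewrite mul1r.
by rewrite mulNmx mul1mx expr1 scaleN1r opprK.
Qed.

(** Here gamma r has square - 2 = 1, so it preserves the symplectic form, but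
    it changes the sign of the Clifford action like any reflection. *)
Lemma cospin_norm2 r : <[r | r]> = 2 -> cospin (refl (lat_L 3) 1 r).
Proof.
move=> rr; exists (gamma r), (gamma r), true.
have gK : involutive (gamma r).
  by move=> psi; rewrite gamma_sqr rr (rmorph_nat _ 2) F3_two opprK spinZ1.
split=> // [v psi|psi phi].
  rewrite scaleN1r; apply: gamma_reflection.
  by rewrite rr !rmorph1 mul1r rmorphD rmorph1.
by rewrite gamma_adjoint gK mul1r.
Qed.

(** If s is true, P anticommutes with all vectors; a product of five suitable
    vectors is the projection to the upper block, which contains psi0, and
    this forces P psi0 = - P psi0. If s is false, P commutes with all
    vectors, hence is a scalar a on psi0 and phi0; then a ^ 2 = - 1 because P
    is antisymplectic, but - 1 is not a square in F_3. *)
Lemma no_odd_scalar P Q s : intertwines 1%:M P Q s (~~ s) -> False.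
Proof.
pose o1 : 'I_3 := lift ord0 ord0; pose o2 : 'I_3 := lift ord0 (lift ord0 ord0).
have gE (l : 'cV[E]_3) mu nu p1 p2 q1 q2 x1 x2 x3 y z :
    (mod_theta (l ord0 0), mod_theta (l o1 0), mod_theta (l o2 0),
     mod_theta mu, mod_theta nu)
      = (x1, x2, x3, y, z) ->
    gamma (vec_L l mu nu) (p1, p2, q1, q2) =
    cliff 1 1 (x1, x2, x3, y, z) (p1, p2, q1, q2).
  by move=> <-; rewrite unlock coords_vec_L.
pose Y := vec_L (0 : 'cV[E]_3) 1 0; pose Z := vec_L (0 : 'cV[E]_3) 0 1.
pose X := vec_L (unitv ord0 : 'cV[E]_3) 0 0.
pose S := vec_L (- unitv o1 - unitv o2) 0 0.
pose T := vec_L (unitv o1 - unitv o2) 0 0.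
have YE p1 p2 q1 q2 : gamma Y (p1, p2, q1, q2) = (q1, q2, 0, 0).
  rewrite (gE 0 1 0 p1 p2 q1 q2 0 0 0 1 0) /=; last first.
    by rewrite !mxE; congr (_, _, _, _, _); apply/val_inj.
  by rewrite F3_two; congr (_, _, _, _); ring.
have ZE p1 p2 q1 q2 : gamma Z (p1, p2, q1, q2) = (0, 0, p1, p2).
  rewrite (gE 0 0 1 p1 p2 q1 q2 0 0 0 0 1) /=; last first.
    by rewrite !mxE; congr (_, _, _, _, _); apply/val_inj.
  by rewrite F3_two; congr (_, _, _, _); ring.
have XE p1 p2 q1 q2 : gamma X (p1, p2, q1, q2) = (p2, - p1, - q2, q1).
  rewrite (gE (unitv ord0) 0 0 p1 p2 q1 q2 1 0 0 0 0) /=; last first.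
    by rewrite !mxE; congr (_, _, _, _, _); apply/val_inj.
  by rewrite F3_two; congr (_, _, _, _); ring.
have SE p1 p2 q1 q2 : gamma S (p1, p2, q1, q2) = (p1, - p2, - q1, q2).
  rewrite (gE (- unitv o1 - unitv o2) 0 0 p1 p2 q1 q2 0 2 2 0 0) /=; last first.
    by rewrite !mxE; congr (_, _, _, _, _); apply/val_inj.
  rewrite [1 * 2 + 1 * 2](_ : _ = 1); last exact/val_inj.
  by rewrite F3_two; congr (_, _, _, _); ring.
have TE p1 p2 q1 q2 : gamma T (p1, p2, q1, q2) = (- p2, - p1, q2, q1).
  rewrite (gE (unitv o1 - unitv o2) 0 0 p1 p2 q1 q2 0 1 (-1) 0 0) /=; last first.
    by rewrite !mxE; congr (_, _, _, _, _); apply/val_inj.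
  rewrite [1 * 1 - 1 * -1](_ : _ = -1); last exact/val_inj.
  by rewrite F3_two; congr (_, _, _, _); ring.
have zE a p1 p2 q1 q2 : spinZ a (p1, p2, q1, q2) =
    (a * p1, a * p2, a * q1, a * q2) :> spinor F by [].
move=> [_ _ Pg Pt].
have PgE v psi : P (gamma v psi) = spinZ ((-1) ^+ s) (gamma v (P psi)).
  by rewrite Pg mul1mx gamma_sign.
pose psi0 : spinor F := (1, 0, 0, 0).
case E0 : (P psi0) => [[[a b] c] d].
pose phi0 := gamma Z (gamma X psi0).
have phi0E : phi0 = (0, 0, 0, -1) by rewrite /phi0 XE ZE.
(* S, X and T play the roles of - (j + k), i and j - k, with i (j + k) = k - j
   and (j - k) ^ 2 = - 2 = 1; Y and Z project to the upper block. *)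
have oddE : gamma T (gamma X (gamma S (gamma Y (gamma Z psi0)))) = psi0.
  by rewrite ZE YE SE XE TE !oppr0 opprK.
have evenE : gamma S psi0 = psi0 by rewrite SE !oppr0.
have sympE := Pt psi0 phi0.
have F3_opp (x : F) : x = - x -> x = 0.
  move=> e; apply: oppr_inj; rewrite oppr0 -mulN1r -F3_two mulr_natl mulr2n.
  by rewrite {2}e subrr.
have := congr1 P oddE; rewrite !PgE E0.
have symp0E : symp psi0 phi0 = -1 by rewrite phi0E /symp; ring.
have F3_sqr (x : F) : x * x <> -1.
  by case: x => [[|[|[|//]]] ?] /(congr1 val).
rewrite symp0E E0 in sympE.
case: s PgE sympE {Pg Pt} => PgE.
  rewrite expr1 ZE zE YE zE SE zE XE zE TE zE expr0 mul1r !mulN1r !oppr0 !opprK.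
  move=> sympE -[/esym/F3_opp a0 /esym/F3_opp b0 c0 d0].
  move: sympE; rewrite a0 b0 -c0 -d0; case: (P phi0) => [[[p1 p2] q1] q2].
  by rewrite /symp !mul0r !subr0 addr0 => /eqP.
rewrite expr0 !spinZ1 ZE YE SE XE TE expr1 => sympE [_ _ c0 d0].
have := congr1 P evenE; rewrite PgE E0 expr0 spinZ1 SE => -[/esym/F3_opp b0 _].
move: sympE; rewrite /phi0 !PgE E0 expr0 !spinZ1 XE ZE b0 -c0 -d0 /symp.
rewrite !(mul0r, mulr0, oppr0) !addr0 mulN1r opprK => aa.
by apply: (F3_sqr a); rewrite -[a * a]opprK -mulrN aa.
Qed.

Lemma not_spin_cospin g : g \in unitmx -> spin g -> cospin g -> False.
Proof.
move=> ug [P [Q [s Pg]]] [P' [Q' [s' Pg']]].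
have := intertwinesM (intertwinesV ug Pg') Pg; rewrite mulVmx //.
by rewrite addNb => /no_odd_scalar.
Qed.

End SpinLifts.

(** * Padding L with further coordinates *)

Section Padding.
Variable n : nat.
Implicit Types (v w r : 'cV[E]_(n + (1 + 1))) (g : 'M[E]_(n + (1 + 1)))
  (a b : E).

Definition pad a v : 'cV[E]_(n.+1 + (1 + 1)) :=
  col_mx (col_mx a%:M (usubmx v) : 'cV_(1 + n)) (dsubmx v).

Lemma pad_vec_L a l mu nu :
  pad a (vec_L l mu nu) = vec_L (col_mx a%:M l : 'cV_(1 + n)) mu nu.
Proof. by rewrite /pad /vec_L col_mxKu col_mxKd. Qed.

Lemma padD a b v w : pad a v + pad b w = pad (a + b) (v + w).
Proof.
have [l [mu [nu ->]]] := vec_LP v; have [l' [mu' [nu' ->]]] := vec_LP w.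
rewrite vec_LD !pad_vec_L vec_LD; congr (vec_L _ _ _).
by rewrite raddfD /= [RHS](esym (add_col_mx _ _ _ _)).
Qed.

Lemma padZ c a v : c *: pad a v = pad (c * a) (c *: v).
Proof.
have [l [mu [nu ->]]] := vec_LP v.
rewrite vec_LZ !pad_vec_L vec_LZ; congr (vec_L _ _ _).
by rewrite -(scale_scalar_mx 1 c a); exact: (@scale_col_mx E 1 n 1).
Qed.

Lemma padP (v : 'cV[E]_(n.+1 + (1 + 1))) : exists a w, v = pad a w.
Proof.
have [l [mu [nu ->]]] := vec_LP v.
exists (usubmx (l : 'cV_(1 + n)) 0 0), (vec_L (dsubmx (l : 'cV_(1 + n))) mu nu).
by rewrite pad_vec_L -mx11_scalar vsubmxK.
Qed.

Lemma herm_pad a b v w : <[pad a v | pad b w]> = eis_conj a * b + <[v | w]>.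
Proof.
have [l [mu [nu ->]]] := vec_LP v; have [l' [mu' [nu' ->]]] := vec_LP w.
rewrite !pad_vec_L !herm_vec_L !addrA; congr (_ + _ + _).
have head (b' : E) (k : 'cV[E]_n) : (col_mx b'%:M k : 'cV_(1 + n)) ord0 0 = b'.
  transitivity ((col_mx b'%:M k : 'cV_(1 + n)) (lshift n ord0) 0).
    by congr fun_of_matrix; apply: val_inj.
  by rewrite col_mxEu mxE.
have tail (b' : E) (k : 'cV[E]_n) i :
    (col_mx b'%:M k : 'cV_(1 + n)) (lift ord0 i) 0 = k i 0.
  transitivity ((col_mx b'%:M k : 'cV_(1 + n)) (rshift 1 i) 0).
    by congr fun_of_matrix; apply: val_inj.
  by rewrite col_mxEd.
rewrite {1}/hdot big_ord_recl !head; congr (_ + _).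
by apply: eq_bigr => i _; rewrite !tail.
Qed.

Lemma refl_pad c r a v :
  refl (lat_L n.+1) c (pad 0 r) *m pad a v = pad a (refl (lat_L n) c r *m v).
Proof.
rewrite !reflE herm_pad rmorph0 mul0r add0r -scaleN1r !padZ padD.
by rewrite !mulr0 addr0 scaleN1r.
Qed.

(** A short root of the smaller lattice is one of the larger lattice, and the
    added coordinate is orthogonal to it. *)
Lemma Reflec0_pad g : Reflec0 (lat_L n) g ->
  exists2 g', Reflec0 (lat_L n.+1) g' &
    forall a v, g' *m pad a v = pad a (g *m v).
Proof.
have [_ _ R0u] := Reflec0_mxgroup n; have [_ _ R0u'] := Reflec0_mxgroup n.+1.
move=> Rg.
elim: (Rg) => [{Rg}g||g1 g2 _ [h1 R1 E1] _ [h2 R2 E2]|{Rg}g Rg [h Rh hE]].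
- move=> /short_reflectionE[xi [r [_ u rr ->]]].
  exists (refl (lat_L n.+1) (1 - xi) (pad 0 r)).
    by apply: refl_Reflec0; rewrite // herm_pad rr mulr0 add0r.
  by move=> a v; rewrite refl_pad.
- by exists 1%:M; [exact: gen_1|move=> a v; rewrite !mul1mx].
- exists (h1 *m h2); first exact: gen_mul.
  by move=> a v; rewrite -!mulmxA E2 E1.
exists (invmx h); first exact: gen_inv.
move=> a v; have [ug _] := R0u _ Rg; have [uh _] := R0u' _ Rh.
by rewrite -{1}(mulKVmx ug v) -hE mulKmx.
Qed.

(** After padding, - I lacks only the sign of the added coordinate, which is
    a short reflection. *)
Lemma opp1_pad : Reflec0 (lat_L n) (- 1%:M) -> Reflec0 (lat_L n.+1) (- 1%:M).
Proof.
move=> /Reflec0_pad[g Rg gE].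
have e1 : <[pad 1 0 | pad 1 0]> = 1.
  by rewrite herm_pad rmorph1 mul1r -(scale0r 0) herm_latZr mul0r addr0.
have -> : - 1%:M = refl (lat_L n.+1) (1 - -1) (pad 1 0) *m g.
  apply: eq_mulmx => x; have [a [v ->]] := padP x.
  rewrite mulNmx mul1mx -mulmxA gE reflE herm_pad rmorph1 mul1r.
  rewrite -[herm_lat _ 0 _](_ : 0 = _); last first.
    by rewrite -(scale0r 0) herm_latZl rmorph0 mul0r.
  rewrite mulNmx mul1mx addr0 -!scaleN1r !padZ padD; congr pad; first by ring.
  by rewrite !scaler0 addr0.
apply: gen_mul => //; exact: refl_Reflec0.
Qed.

Definition norm2_refl k : 'M[E]_(k + (1 + 1)) := refl (lat_L k) 1 (vec_L 0 1 1).

Lemma norm2_refl_pad : Reflec0 (lat_L n) (norm2_refl n) ->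
  Reflec0 (lat_L n.+1) (norm2_refl n.+1).
Proof.
move=> /Reflec0_pad[g Rg gE]; suff -> : norm2_refl n.+1 = g by [].
have padr : vec_L 0 1 1 = pad 0 (vec_L 0 1 1).
  by rewrite pad_vec_L raddf0 col_mx0.
apply: eq_mulmx => x; have [a [v ->]] := padP x.
by rewrite gE /norm2_refl padr refl_pad.
Qed.

End Padding.

Lemma lift_to_3 (P : nat -> Prop) n : (forall k, P k -> P k.+1) ->
  (n <= 3)%N -> P n -> P 3%N.
Proof.
move=> PS n3 Pn; rewrite -(subnK n3).
by elim: (3 - n)%N => [|k IH]; [exact: Pn|exact: PS].
Qed.

Lemma opp1_notin_Reflec0 n : (n <= 3)%N -> ~ Reflec0 (lat_L n) (- 1%:M).
Proof.
move=> n3 R1; have R3 := lift_to_3 opp1_pad n3 R1.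
apply: (not_spin_cospin _ (spin_Reflec0 R3) cospin_opp1).
by have [_ _ /(_ _ R3)[]] := Reflec0_mxgroup 3.
Qed.

Lemma herm_norm2 n : <[vec_L 0 1 1 | vec_L (0 : 'cV[E]_n) 1 1]> = 2.
Proof. by rewrite herm_vec_L hdot0l. Qed.

Lemma norm2_refl_notin_Reflec0 n :
  (n <= 3)%N -> ~ Reflec0 (lat_L n) (norm2_refl n).
Proof.
move=> n3 R1; have R3 := lift_to_3 norm2_refl_pad n3 R1.
apply: (not_spin_cospin _ (spin_Reflec0 R3) (cospin_norm2 (herm_norm2 3))).
by have [_ _ /(_ _ R3)[]] := Reflec0_mxgroup 3.
Qed.

Lemma norm2_refl_Aut n : Aut_lat (lat_L n) (norm2_refl n).
Proof.
apply: refl_Aut; [exact: lat_L_herm|exact: lat_L_unimod|].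
by rewrite herm_norm2.
Qed.

(** * Lattice reflections as complex reflections *)

Section BaseChange.
Variables (A B : comUnitRingType) (cjA : A -> A) (cjB : B -> B).
Variable f : {rmorphism A -> B}.
Hypothesis f_conj : forall x, f (cjA x) = cjB (f x).
Variables (m : nat) (G : 'M[A]_m).

Lemma map_mx_conj (x : 'cV[A]_m) :
  map_mx cjB (map_mx f x) = map_mx f (map_mx cjA x).
Proof. by apply/matrixP => i j; rewrite !mxE f_conj. Qed.

Lemma herm_map (x y : 'cV[A]_m) :
  herm cjB (map_mx f G) (map_mx f x) (map_mx f y) = f (herm cjA G x y).
Proof.
rewrite /herm map_mx_conj.
transitivity (map_mx f ((map_mx cjA x)^T *m G *m y) 0 0).
  by rewrite !map_mxM (map_trmx f).
by rewrite [LHS]mxE.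
Qed.

Lemma map_pseudoreflection c (r : 'cV[A]_m) v :
  map_mx f (1%:M - c *: (r *m ((map_mx cjA r)^T *m G))) *m v =
  v - (f c * herm cjB (map_mx f G) (map_mx f r) v) *: map_mx f r.
Proof.
rewrite map_mxB map_scalar_mx rmorph1 map_mxZ !map_mxM /= -map_trmx -map_mx_conj.
rewrite mulmxBl mul1mx -scalemxAl -!mulmxA [_ *m (_ *m v)]mulmxA.
rewrite [_ *m _ *m v]mx11_scalar mul_mx_scalar scalerA /herm.
by [].
Qed.

End BaseChange.

Section PositiveReflections.
Variables (R : realType) (n : nat).

Lemma herm_eisC (x y : 'cV[E]_(n + (1 + 1))) :
  herm (@conjc R) (map_mx (@eisC R) (lat_L n)) (map_mx (@eisC R) x)
    (map_mx (@eisC R) y)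
  = eisC R <[x | y]>.
Proof. exact: (herm_map (@eisC_conj R)). Qed.

Lemma refl_positive xi c r : xi != 1 -> (exists2 k, (0 < k)%N & xi ^+ k = 1) ->
  (exists2 k : nat, (0 < k)%N & <[r | r]> = k%:R) -> c * <[r | r]> = 1 - xi ->
  positive_reflection (lat_L n) R (refl (lat_L n) c r).
Proof.
move=> xi1 [k k0 xik] [N N0 rN] crr; exists (eisC R xi), (map_mx (@eisC R) r).
have NC0 : (0 : R[i]) < N%:R by rewrite ltr0n.
have rC : herm (@conjc R) (map_mx (@eisC R) (lat_L n)) (map_mx (@eisC R) r)
    (map_mx (@eisC R) r) = N%:R by rewrite herm_eisC rN rmorph_nat.
split.
- by apply: contra_neq xi1 => e; apply: (@eisC_inj R); rewrite e rmorph1.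
- by exists k => //; apply/unity_rootP; rewrite -rmorphXn xik rmorph1.
- by rewrite rC.
move=> v; rewrite /reflection rC unlock (map_pseudoreflection (@eisC_conj R)).
congr (_ - _ *: _); rewrite mulrAC; congr (_ * _).
apply: (canRL (mulfK (lt0r_neq0 NC0))).
by rewrite -(rmorph_nat (eisC R)) -rN -rmorphM crr rmorphB rmorph1.
Qed.

End PositiveReflections.

(** * Proof of the theorem *)

Lemma card_set2 (T : Type) (x y : T) : x <> y -> [set x; y] #= `I_2.
Proof.
move=> xy; apply/eq_cardSP; exists x; first by left.
suff -> : [set x; y] `\ x = [set y] by apply: card_set1.
apply/seteqP; split=> [z [[zx /(_ zx)//|//]]|z ->].
by split; [right|move=> /= /esym].
Qed.

Section MainResult.
Variable n : nat.
Local Notation R0 := (Reflec0 (lat_L n)).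
Local Notation rho := (rho n).

Lemma Reflec0_opp g : (n <= 3)%N -> R0 g -> ~ R0 (- g).
Proof.
move=> n3 Rg RNg; apply: (opp1_notin_Reflec0 n3).
have [_ RM RV] := Reflec0_mxgroup n; have [ug RVg] := RV _ Rg.
by rewrite -(mulmxV ug) -mulNmx; apply: RM.
Qed.

(** If h in Reflec0 sends rho to - rho, then - h fixes rho. For n = 1 there
    are no transpositions, so the stabilizer of rho lies in Reflec0 and
    contains - h, which puts - I into Reflec0. *)
Lemma rho_orbits_distinct : n = 1%N -> lat_orbit R0 rho <> lat_orbit R0 (- rho).
Proof.
move=> n1; have n3 : (n <= 3)%N by rewrite n1.
move=> orbE; have [h Rh hr] : lat_orbit R0 rho (- rho).
  by rewrite orbE; apply: (orbit_refl (Reflec0_mxgroup n)).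
apply: (Reflec0_opp n3 Rh).
apply: (fix_null_vector _ (Reflec0_mxgroup n) (fun g Rg => Rg) (@Reflec0_Aut n)).
- by rewrite n1.
- move=> i j /negP[]; apply/eqP/val_inj.
  by have := ltn_ord i; have := ltn_ord j; rewrite /=; lia.
- by apply: Aut_latN; apply: Reflec0_Aut.
by rewrite mulNmx hr opprK.
Qed.

Lemma lat_orbits_rho : (n <= 3)%N ->
  lat_orbits R0 (primitive_null (lat_L n)) =
  [set lat_orbit R0 rho; lat_orbit R0 (- rho)].
Proof.
move=> n3; have Rgrp := Reflec0_mxgroup n; have pn := rho_primitive_null n.
apply/seteqP; split=> [_ [v /(orbit_rho n3)[] vr <-]|_ [->|->]].
- by left; apply: (orbit_eq Rgrp).
- by right; apply: (orbit_eq Rgrp).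
- by exists rho.
exists (- rho) => //; rewrite -[- _]mul1mx mulmxN -mulNmx.
apply: primitive_null_Aut pn; apply: Aut_latN; exact: Aut_lat1.
Qed.

(** The norm 2 reflection in (0; 1, 1) is an automorphism not in Reflec0, so
    its negative is in Reflec0; this exhibits - I as a product of
    reflections. *)
Lemma ReflecE (R : realType) :
  (n <= 3)%N -> (0 < n)%N -> Reflec (lat_L n) R = @Reflec0_pm n.
Proof.
move=> n3 n0; have [R1 RM RV] := Reflec0_mxgroup n.
have AutE := Aut_latE n0 n3.
have Reflec_mx : mxgroup (Reflec (lat_L n) R).
  by apply: generated_mxgroup => g [[]].
case: (Reflec_mx) => _ TM _.
have R0Reflec : R0 `<=` Reflec (lat_L n) R.
  apply: generated_min => // g Sg; apply: gen_in; split.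
    by apply: Reflec0_Aut; apply: gen_in.
  have /short_reflectionE[xi [r [xi1 u rr ->]]] := Sg.
  apply: (@refl_positive _ _ xi) => //; last by rewrite rr mulr1.
  - exists 6%N => //; have [k k3 xik] := unit_cases u.
    by case: xik => ->; move: k k3 => [|[|[|//]]] _.
  - by exists 1%N.
have sReflec : Reflec (lat_L n) R (norm2_refl n).
  apply: gen_in; split; first exact: norm2_refl_Aut.
  apply: (@refl_positive _ _ (-1)) => //.
  - by exists 2%N => //; rewrite sqrrN expr1n.
  - by exists 2%N => //; rewrite herm_norm2.
  - by rewrite herm_norm2 mul1r opprK.
have opp1Reflec : Reflec (lat_L n) R (- 1%:M).
  have : @Reflec0_pm n (norm2_refl n) by rewrite -AutE; apply: norm2_refl_Aut.
  case=> [/(norm2_refl_notin_Reflec0 n3)//|Rs].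
  have [_ _ /(_ _ Rs)[us RVs]] := Reflec0_mxgroup n.
  rewrite -(mulmxV us) -mulNmx opprK; apply: TM => //; exact: R0Reflec.
apply/seteqP; split=> [g|g [/R0Reflec//|/R0Reflec Rg]].
  by rewrite -AutE; apply: generated_Aut => {}g [].
by rewrite -[g]opprK -[- g]mul1mx -mulNmx; apply: TM.
Qed.

Lemma Reflec0_pm_direct_product : (n <= 3)%N ->
  internal_direct_product (@Reflec0_pm n) R0 [set 1%:M; - 1%:M].
Proof.
move=> n3; have [R1 _ _] := Reflec0_mxgroup n; split.
- apply/seteqP; split=> [g [Rg|Rg]|_ [g Rg [_ [->|->] <-]]].
  + by exists g => //; exists 1%:M; [left|rewrite mulmx1].
  + by exists (- g) => //; exists (- 1%:M); [right|rewrite mulmxN mulmx1 opprK].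
  + by left; rewrite mulmx1.
  + by right; rewrite mulmxN mulmx1 opprK.
- apply/seteqP; split=> [g [Rg [//|gE]]|_ ->]; last by split=> //; left.
  by move: Rg; rewrite gE => /(opp1_notin_Reflec0 n3).
by move=> g _ _ [->|->]; rewrite ?mulmxN ?mulNmx mulmx1 mul1mx.
Qed.

End MainResult.

Theorem theorem6p6 (R : realType) (n : nat) :
  [/\ n = 1%N ->
        lat_orbits (Reflec0 (lat_L n)) (primitive_null (lat_L n)) #= `I_2 /\
        lat_orbits (Reflec0 (lat_L n)) (primitive_null (lat_L n)) =
          [set lat_orbit (Reflec0 (lat_L n)) (rho n);
               lat_orbit (Reflec0 (lat_L n)) (- rho n)],
      n = 2%N \/ n = 3%N ->
        transitive_on (Reflec0 (lat_L n)) (primitive_null (lat_L n))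
    & n = 1%N \/ n = 2%N \/ n = 3%N ->
        Aut_lat (lat_L n) = Reflec (lat_L n) R /\
        internal_direct_product (Reflec (lat_L n) R)
          (Reflec0 (lat_L n)) [set 1%:M; - 1%:M]].
Proof.
split=> [n1|n23|n123].
- have orbE := @lat_orbits_rho n _; rewrite orbE ?n1 //; split=> //.
  by apply/card_set2/rho_orbits_distinct.
- by apply: transitive_Reflec0; case: n23 => ->.
have [n0 n3] : (0 < n)%N /\ (n <= 3)%N by case: n123 => [->|[->|->]].
rewrite (ReflecE R n3 n0); split; first exact: Aut_latE.
exact: Reflec0_pm_direct_product.
Qed.
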